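(* There is a constant $C$ independent of $\tau$ such that the iterates of the splitting scheme satisfy $\frac1{2\tau}\sum_{n=0}^{N-1}\Big[W_2^2(\rho^{n+1/2},\rho^{n+1})+W_2^2(\eta^{n+1/2},\eta^{n+1})\Big]\le C$.
   Context: Setting. $\Omega\subset\mathbb R$ is a bounded open interval and $T>0$. $BV(\Omega)$ is the space of functions $f:\bar\Omega\to\mathbb R$ with finite total variation $|f|_{BV}:=\sup_P\sum_{i=1}^{|P|-1}|f(x_{i+1})-f(x_i)|$, the supremum over finite partitions $P=\{x_1<\dots<x_{|P|}\}\subset\Omega$. A function $\chi:[0,\infty)\to\mathbb R$ is an internal energy density: $\chi\in C^0([0,\infty))\cap C^2((0,\infty))$, $\chi''>0$ on $(0,\infty)$, $\lim_{h\downarrow0}\chi'(h)=0$, and the integrals $\kappa(x):=\int_1^x\frac{\chi''(s)}{s}\,ds$ and $K(\sigma):=\int_0^\sigma\kappa(x)\,dx$ exist. Put $\mathcal K(\sigma):=\int_\Omega K(\sigma)\,dx$ and $\mathcal E(\rho,\eta):=\int_\Omega\chi(\rho+\eta)\,dx$. The functions $F_1,F_2,G_1,G_2:[0,\infty)^2\to\mathbb R$ are bounded and Lipschitz, with $G_1(0,\eta)\ge0$ for all $\eta\ge0$ and $G_2(\rho,0)\ge0$ for all $\rho\ge0$. For $\sigma\ge0$, $r\in[0,1]$ set $\tilde F_i(\sigma,r)=F_i(r\sigma,(1-r)\sigma)$, $\tilde G_i(\sigma,r)=G_i(r\sigma,(1-r)\sigma)$, $A_1=\tilde F_1+\tilde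 G_2$, $A_2=\tilde G_1+\tilde F_2$, $A_3=\tilde F_1-\tilde F_2$, $\Sigma(\sigma,r)=\sigma(rA_1+(1-r)A_2)$, $R(\sigma,r)=r(1-r)A_3+(1-r)^2\tilde G_1-r^2\tilde G_2$. Initial data: $\rho_0,\eta_0\in BV(\Omega)\cap L^\infty(\Omega)$ nonnegative, $\sigma_0=\rho_0+\eta_0$, and $r_0\in BV(\Omega)$ with $0\le r_0\le1$ and $r_0=\rho_0/\sigma_0$ on $\{\sigma_0>0\}$. For $m>0$, $\mathcal P^m(\Omega)$ is the set of nonnegative Borel measures on $\Omega$ of total mass $m$; $W_p$ ($p=1,2$) is the $p$-Wasserstein distance between measures of equal mass, $W_p^p(\mu,\nu)=\inf_\gamma\int|x-y|^p\,d\gamma$ over couplings $\gamma$ of $\mu,\nu$. Splitting scheme. Fix $\tau\in(0,1)$ and $N\in\mathbb N$ with $N\tau=T$; set $r^0=r_0$, $\sigma^0=\sigma_0$. For $n=0,\dots,N-1$: (Reaction step) for each $x\in\Omega$ solve $\dot\sigma=\Sigma(\sigma,r)$, $\dot r=R(\sigma,r)$ on $[0,\tau]$ with $\sigma(0)=\sigma^n(x)$, $r(0)=r^n(x)$, and set $\sigma^{n+1/2}(x)=\sigma(\tau)$, $r^{n+1/2}(x)=r(\tau)$, $\rho^{n+1/2}=r^{n+1/2}\sigma^{n+1/2}$, $\eta^{n+1/2}=(1-r^{n+1/2})\sigma^{n+1/2}$, $U^{n+1/2}=(\rho^{n+1/2},\eta^{n+1/2})$. (Diffusion step) with $m_1=\int_\Omega\rho^{n+1/2}$,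 $m_2=\int_\Omega\eta^{n+1/2}$, let $U^{n+1}=(\rho^{n+1},\eta^{n+1})$ be a minimiser over $(\rho,\eta)\in\mathcal P^{m_1}(\Omega)\times\mathcal P^{m_2}(\Omega)$ of $\frac1{2\tau}\big[W_2^2(\rho,\rho^{n+1/2})+W_2^2(\eta,\eta^{n+1/2})\big]+\mathcal E(\rho,\eta)$; set $\sigma^{n+1}=\rho^{n+1}+\eta^{n+1}$ and $r^{n+1}=r^{n+1/2}\circ\mathcal T$, where $\mathcal T$ is the nondecreasing optimal transport map pushing $\sigma^{n+1}$ forward to $\sigma^{n+1/2}$. Also $\rho^n=r^n\sigma^n$, $\eta^n=(1-r^n)\sigma^n$, $U^n=(\rho^n,\eta^n)$. Piecewise constant interpolation: for $t\in[n\tau,(n+1)\tau)$, $r_\tau(t)=r^n$, $\sigma_\tau(t)=\sigma^n$, $\rho_\tau(t)=r^n\sigma^n$, $\eta_\tau(t)=(1-r^n)\sigma^n$, $U_\tau=(\rho_\tau,\eta_\tau)$. *)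

(* Defs.v *)
From HB Require Import structures.
From mathcomp Require Import all_boot all_order all_algebra.
From mathcomp Require Import all_classical all_reals all_analysis.
Set Implicit Arguments. Unset Strict Implicit. Unset Printing Implicit Defensive.
Import Order.TTheory GRing.Theory Num.Theory.
Import numFieldNormedType.Exports.
Local Open Scope classical_set_scope.
Local Open Scope ring_scope.

Section Defs.
Variable R : realType.
Notation mu := (@lebesgue_measure R).

Definition is_BV (a b : R) (f : R -> R) : Prop :=
  exists M : R, forall s : seq R,
    sorted (fun x y => x < y) s -> all (fun x => (a < x) && (x < b)) s ->
    \sum_(i < (size s).-1) `|f (nth 0 s i.+1) - f (nth 0 s i)| <= M.

Definition bounded_on (a b : R) (f : R -> R) : Prop :=
  exists M : R, forall x, a < x < b -> `|f x| <= M.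

Definition bdd_lip2 (F : R -> R -> R) : Prop :=
  (exists M : R, forall u v, 0 <= u -> 0 <= v -> `|F u v| <= M) /\
  (exists L : R, forall u v u' v', 0 <= u -> 0 <= v -> 0 <= u' -> 0 <= v' ->
      `|F u v - F u' v'| <= L * (`|u - u'| + `|v - v'|)).

Definition kappa (chi : R -> R) (x : R) : R :=
  if 1 <= x then Rintegral mu `[1, x] (fun s => (derive1n 2 chi) s / s)
  else - Rintegral mu `[x, 1] (fun s => (derive1n 2 chi) s / s).

Definition internal_energy_density (chi : R -> R) : Prop :=
  {within `[0, +oo[, continuous chi} /\
  (forall x, 0 < x -> derivable chi x 1 /\ derivable (derive1 chi) x 1 /\
                      {for x, continuous (derive1n 2 chi)}) /\
  (forall x, 0 < x -> 0 < (derive1n 2 chi) x) /\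
  ((derive1 chi) x @[x --> 0^'+] --> 0) /\
  (forall x, 0 < x -> mu.-integrable `[Order.min 1 x, Order.max 1 x]
                          (fun s => ((derive1n 2 chi) s / s)%:E)) /\
  (* the integral defining K exists *)
  (forall sg, 0 <= sg -> mu.-integrable `]0, sg] (fun x => (kappa chi x)%:E)).

Definition couplings (a b : R) (f g : R -> R) : set {measure set (R * R)%type -> \bar R} :=
  [set gam | forall A : set R, measurable A ->
     (gam (A `*` setT) = \int[mu]_(x in A `&` `]a, b[) (f x)%:E)%E /\
     (gam (setT `*` A) = \int[mu]_(x in A `&` `]a, b[) (g x)%:E)%E].

Definition Wpp (p : nat) (a b : R) (f g : R -> R) : \bar R :=
  ereal_inf [set (\int[gam]_z (`|z.1 - z.2| ^+ p)%:E)%E | gam in couplings a b f g].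

Definition mass (a b : R) (f : R -> R) : \bar R := (\int[mu]_(x in `]a, b[) (f x)%:E)%E.

Definition admissible (a b : R) (m : \bar R) (f : R -> R) : Prop :=
  (forall x, a < x < b -> 0 <= f x) /\
  mu.-integrable `]a, b[ (fun x => (f x)%:E) /\ mass a b f = m.

Definition energy (a b : R) (chi : R -> R) (p e : R -> R) : \bar R :=
  (\int[mu]_(x in `]a, b[) (chi (p x + e x))%:E)%E.

Definition JKO_functional (a b tau : R) (chi : R -> R) (ph eh p e : R -> R) : \bar R :=
  (((2 * tau)^-1)%:E * (Wpp 2 a b p ph + Wpp 2 a b e eh) + energy a b chi p e)%E.

End Defs.

(* Main.v *)
Require Import Defs.
From HB Require Import structures.
From mathcomp Require Import all_boot all_order all_algebra.
From mathcomp Require Import all_classical all_reals all_analysis.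
From mathcomp Require Import measurable_realfun ring lra.
Set Implicit Arguments. Unset Strict Implicit. Unset Printing Implicit Defensive.
Import Order.TTheory GRing.Theory Num.Theory.
Import numFieldNormedType.Exports.
Local Open Scope classical_set_scope.
Local Open Scope ring_scope.

(** Comparing the minimiser with U^{n+1/2} bounds the transport cost of step n
    by the energy drop E(U^{n+1/2}) - E(U^{n+1}).  By Gronwall the reaction step
    multiplies sigma by at most e^{C tau}, so it raises the energy by O(tau), and
    the sum telescopes, provided that sigma^n is bounded uniformly in n and tau.

    This bound is a maximum principle for the minimisation step: if
    sigma^{n+1/2} <= M then sigma^{n+1} <= M almost everywhere.  Otherwise, move a
    fraction e of the mass of the region A = {sigma^{n+1} > M} along the coupling
    all the way back to where it came from.  The cost does not increase, the
    density that arrives is at most M, and the energy drops to first order in e.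

    The half-step densities may fail to be Borel measurable: r^{n+1} is arbitrary
    where sigma^{n+1} vanishes.  As the integral of a nonnegative function is its
    lower integral, they can be replaced by measurable minorants that have the
    same couplings. *)

Lemma density_mvt (R : realType) (chi : R -> R) (x y : R) :
  internal_energy_density chi -> 0 <= x -> x < y ->
  exists2 c, x < c < y & chi y - chi x = derive1 chi c * (y - x).
Proof.
move=> [cchi [dchi _]] x0 xy.
have [||c] := @MVT R chi (derive1 chi) x y xy.
- move=> z; rewrite in_itv/= => /andP[xz _].
  have [d1 _] := dchi z (le_lt_trans x0 xz).
  by rewrite derive1E; apply: DeriveDef.
- apply: continuous_subspaceW cchi => z/=; rewrite !in_itv/= andbT.
  by move=> /andP[xz _]; exact: le_trans xz.
- by rewrite in_itv/= => cxy ->; exists c.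
Qed.

Lemma density_derive1_incr (R : realType) (chi : R -> R) (x y : R) :
  internal_energy_density chi -> 0 < x -> x < y -> derive1 chi x < derive1 chi y.
Proof.
move=> [_ [dchi [d2 _]]] x0 xy.
apply: (@gtr0_derive1_incr _ (derive1 chi) x y) => //.
- move=> z; rewrite in_itv/= => /andP[xz _].
  by have [_ [dd _]] := dchi z (lt_trans x0 xz); exact: dd.
- move=> z; rewrite in_itv/= => /andP[xz _].
  exact: d2 z (lt_trans x0 xz).
- apply: derivable_within_continuous => z; rewrite in_itv/= => /andP[xz _].
  by have [_ [dd _]] := dchi z (lt_le_trans x0 xz); exact: dd.
Qed.

Lemma density_derive1_gt0 (R : realType) (chi : R -> R) (x : R) :
  internal_energy_density chi -> 0 < x -> 0 < derive1 chi x.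
Proof.
move=> hchi x0; have x20 : 0 < x / 2 by rewrite divr_gt0.
have xx : x / 2 < x by lra.
apply: le_lt_trans (density_derive1_incr hchi x20 xx).
have [_ [_ [_ [lim0 _]]]] := hchi.
have -> : 0 = lim (derive1 chi z @[z --> 0^'+]) :> R by apply/esym/cvg_lim.
apply: limr_le; first by apply/cvg_ex; exists 0.
near=> z; apply/ltW/(density_derive1_incr hchi).
  by near: z; exact: nbhs_right_gt.
by near: z; exact: nbhs_right_lt.
Unshelve. all: by end_near. Qed.

Lemma density_nd (R : realType) (chi : R -> R) (x y : R) :
  internal_energy_density chi -> 0 <= x -> x <= y -> chi x <= chi y.
Proof.
move=> hchi x0; rewrite le_eqVlt => /predU1P[->//|xy].
have [c /andP[xc _] e] := density_mvt hchi x0 xy.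
rewrite -subr_ge0 e mulr_ge0 ?subr_ge0 ?(ltW xy)//.
by apply/ltW/(density_derive1_gt0 hchi)/(le_lt_trans x0).
Qed.

Lemma density_dilation (R : realType) (chi : R -> R) (k s B : R) :
  internal_energy_density chi -> 1 <= k -> 0 <= s -> k * s <= B -> 0 < B ->
  chi (k * s) <= chi s + derive1 chi B * (k - 1) * B.
Proof.
move=> hchi k1 s0 ksB B0; have sB : s <= B by apply: le_trans ksB; exact: ler_peMl.
have dB : 0 < derive1 chi B by exact: density_derive1_gt0.
have [sks|] := ltP s (k * s); last first.
  move=> kss; have -> : k * s = s.
    by apply/eqP; rewrite eq_le kss ler_peMl.
  by rewrite lerDl !mulr_ge0 ?(ltW dB) ?(ltW B0)//; lra.
have [c /andP[sc cks] e] := density_mvt hchi s0 sks.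
rewrite -lerBlDl e.
have c0 := le_lt_trans s0 sc.
have dc : derive1 chi c <= derive1 chi B.
  by apply/ltW/(density_derive1_incr hchi) => //; exact: lt_le_trans ksB.
have -> : k * s - s = (k - 1) * s by ring.
rewrite -mulrA; apply: ler_pM => //.
- by apply/ltW/(density_derive1_gt0 hchi).
- by rewrite mulr_ge0// subr_ge0.
- by rewrite ler_wpM2l// subr_ge0.
Qed.

Definition bregman (R : realType) (chi : R -> R) (M s : R) : R :=
  chi s - chi M - derive1 chi M * (s - M).

Lemma bregman_nincr (R : realType) (chi : R -> R) (M x y : R) :
  internal_energy_density chi -> 0 < M -> 0 <= x -> x <= y -> y <= M ->
  bregman chi M y <= bregman chi M x.
Proof.
move=> hchi M0 x0; rewrite le_eqVlt => /predU1P[->//|xy] yM.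
have [c /andP[xc cy] e] := density_mvt hchi x0 xy.
have := density_derive1_incr hchi (le_lt_trans x0 xc) (lt_le_trans cy yM).
rewrite /bregman => dcM.
suff : chi y - chi x <= derive1 chi M * (y - x) by lra.
by rewrite e ler_wpM2r// ?(ltW dcM)// subr_ge0 ltW.
Qed.

Lemma bregman_incr (R : realType) (chi : R -> R) (M x y : R) :
  internal_energy_density chi -> 0 < M -> M <= x -> x < y ->
  bregman chi M x < bregman chi M y.
Proof.
move=> hchi M0 Mx xy.
have [c /andP[xc cy] e] := density_mvt hchi (le_trans (ltW M0) Mx) xy.
have := density_derive1_incr hchi M0 (le_lt_trans Mx xc).
rewrite /bregman => dcM.
suff : derive1 chi M * (y - x) < chi y - chi x by lra.
by rewrite e ltr_pM2r// subr_gt0.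
Qed.

Lemma bregmanxx (R : realType) (chi : R -> R) (M : R) : bregman chi M M = 0.
Proof. by rewrite /bregman !subrr mulr0 subr0. Qed.

Lemma bregman_ge0 (R : realType) (chi : R -> R) (M s : R) :
  internal_energy_density chi -> 0 < M -> 0 <= s -> 0 <= bregman chi M s.
Proof.
move=> hchi M0 s0; rewrite -(bregmanxx chi M).
have [sM|Ms] := leP s M; first exact: bregman_nincr.
exact/ltW/bregman_incr.
Qed.

Lemma bregman_convex (R : realType) (chi : R -> R) (M s e : R) :
  internal_energy_density chi -> 0 < M -> M < s -> 0 < e < 1 ->
  bregman chi M ((1 - e) * s + e * M) <= (1 - e) * bregman chi M s.
Proof.
move=> hchi M0 Ms /andP[e0 e1]; set t := _ + _.
have Mt : M < t by rewrite /t; nra.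
have ts : t < s by rewrite /t; nra.
have [c /andP[tc cs] ec] := density_mvt hchi (ltW (lt_trans M0 Mt)) ts.
have [d /andP[Md dt] ed] := density_mvt hchi (ltW M0) Mt.
have dc := density_derive1_incr hchi (lt_trans M0 Md) (lt_trans dt tc).
have tE : t - M = (1 - e) * (s - M) by rewrite /t; ring.
have stE : s - t = e * (s - M) by rewrite /t; ring.
rewrite tE in ed; rewrite stE in ec.
rewrite /bregman tE.
have -> : chi t - chi M = derive1 chi d * ((1 - e) * (s - M)) by [].
have -> : chi s - chi M = derive1 chi c * (e * (s - M)) + derive1 chi d * ((1 - e) * (s - M)).
  by rewrite -ec -ed; ring.
rewrite -subr_ge0.
have -> : (1 - e) *
   (derive1 chi c * (e * (s - M)) + derive1 chi d * ((1 - e) * (s - M)) -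
    derive1 chi M * (s - M)) -
   (derive1 chi d * ((1 - e) * (s - M)) - derive1 chi M * ((1 - e) * (s - M)))
   = (1 - e) * e * (s - M) * (derive1 chi c - derive1 chi d) by ring.
by rewrite !mulr_ge0// ?subr_ge0 ltW.
Qed.

(* Moving a fraction [e] of the mass of the region [s > M] to a density
   [v <= M] decreases the energy to first order in [e]. *)
Lemma bregman_transfer (R : realType) (chi : R -> R) (M s v e : R) :
  internal_energy_density chi -> 0 < M -> 0 <= s -> 0 <= v <= M -> 0 < e < 1 ->
  bregman chi M (if M < s then (1 - e) * s + e * v else s + e * v)
    + (if M < s then e * bregman chi M s else 0)
  <= bregman chi M s
     + (bregman chi M (M + e * M) + bregman chi M (M - e * M)).
Proof.
move=> hchi M0 s0 /andP[v0 vM] e01; have /andP[e0 e1] := e01.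
have eM0 : 0 < e * M by rewrite mulr_gt0.
have eMM : e * M < M by rewrite gtr_pMl.
have b1 : 0 <= bregman chi M (M + e * M) by apply: bregman_ge0 => //; lra.
have b2 : 0 <= bregman chi M (M - e * M) by apply: bregman_ge0 => //; lra.
have evM : e * v <= e * M by rewrite ler_wpM2l// ltW.
have ev0 : 0 <= e * v by rewrite mulr_ge0// ltW.
have bs := bregman_ge0 hchi M0 s0.
case: ltP => [Ms|sM].
  set t := (1 - e) * s + e * v.
  have [tM|Mt] := leP t M.
    have : bregman chi M t <= bregman chi M (M - e * M).
      apply: bregman_nincr => //; first lra.
      have : (1 - e) * M <= (1 - e) * s by rewrite ler_wpM2l ?subr_ge0// ltW.
      by rewrite /t; lra.
    have : e * bregman chi M s <= bregman chi M s by rewrite ler_piMl// ltW.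
    by lra.
  have tt : t <= (1 - e) * s + e * M by rewrite /t lerD2l.
  have : bregman chi M t <= (1 - e) * bregman chi M s.
    apply: le_trans (bregman_convex hchi M0 Ms e01).
    move: tt; rewrite le_eqVlt => /predU1P[->//|tt].
    by apply/ltW/bregman_incr => //; exact: ltW.
  by lra.
have [tM|Mt] := leP (s + e * v) M.
  have : bregman chi M (s + e * v) <= bregman chi M s.
    by apply: bregman_nincr => //; lra.
  by lra.
have : bregman chi M (s + e * v) <= bregman chi M (M + e * M).
  have : s + e * v <= M + e * M by lra.
  rewrite le_eqVlt => /predU1P[->//|?].
  by apply/ltW/bregman_incr => //; exact: ltW.
by lra.
Qed.

Lemma bregman_littleo (R : realType) (chi : R -> R) (M d : R) :
  internal_energy_density chi -> 0 < M -> 0 < d -> exists2 e, 0 < e < 1 &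
  bregman chi M (M + e * M) + bregman chi M (M - e * M) <= d * e.
Proof.
move=> hchi M0 d0.
have [_ [dchi _]] := hchi; have [dM _] := dchi M M0.
have d'0 : 0 < d / (2 * M) by rewrite divr_gt0// mulr_gt0.
have := dM; rewrite /derivable => /cvg_ex[l hl].
have lE : derive1 chi M = l by rewrite derive1E; apply/cvg_lim.
have /cvgrPdist_le /(_ _ d'0) := hl.
rewrite /dnbhs /within /= => /nbhs_ballP[r /= r0 hr].
have est h : h != 0 -> `|h| < r -> bregman chi M (M + h) <= d / (2 * M) * `|h|.
  move=> h0 hr0; have := hr h; rewrite /ball/= sub0r normrN => /(_ hr0 h0).
  rewrite /= /GRing.scale /= mulr1 => {}hr.
  rewrite /bregman lE (addrC M h) addrK.
  have -> : chi (h + M) - chi M - l * h = - ((l - h^-1 * (chi (h + M) - chi M)) * h).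
    rewrite mulrBl mulrAC mulVf// mul1r; ring.
  apply: le_trans (ler_norm _) _; rewrite normrN normrM.
  by rewrite ler_wpM2r.
pose e := Num.min (2^-1) (r / (2 * M)).
have e0 : 0 < e by rewrite /e lt_min invr_gt0 ltr0n/= divr_gt0// mulr_gt0.
have e1 : e < 1.
  have : e <= 2^-1 by rewrite /e ge_min lexx.
  by lra.
have er : e * M < r.
  have : e <= r / (2 * M) by rewrite /e ge_min lexx orbT.
  move=> /(ler_wpM2r (ltW M0)).
  have -> : r / (2 * M) * M = r / 2 by field; rewrite gt_eqF.
  by lra.
have eM0 : 0 < e * M by rewrite mulr_gt0.
exists e; first by rewrite e0.
have E1 := est (e * M); rewrite gt_eqF// gtr0_norm// in E1.
have E2 := est (- (e * M)); rewrite oppr_eq0 gt_eqF// normrN gtr0_norm// in E2.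
have -> : d * e = d / (2 * M) * (e * M) + d / (2 * M) * (e * M).
  by field; rewrite gt_eqF.
by rewrite lerD// ?E1 ?E2.
Qed.

(* [integral] is a supremum over simple functions below the integrand, so no
   measurability is needed. *)
Lemma ge0_le_lower_integral d (T : measurableType d) (R : realType)
    (mu : {measure set T -> \bar R}) (D : set T) (f g : T -> \bar R) :
  (forall x, D x -> (0 <= f x)%E) -> (forall x, D x -> (f x <= g x)%E) ->
  (\int[mu]_(x in D) f x <= \int[mu]_(x in D) g x)%E.
Proof.
move=> f0 fg; rewrite !ge0_integralE//; last first.
  by move=> x Dx; rewrite (le_trans (f0 _ Dx))// fg.
apply: ereal_sup_le => _ [h /= hf <-]; exists h => // x.
exact: le_trans (hf x) (lee_restrict fg x).
Qed.

Section measurable_minorant.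
Import HBNNSimple.

Lemma measurable_minorant d (T : measurableType d) (R : realType)
    (mu : {measure set T -> \bar R}) (D : set T) (f : T -> R) :
  measurable D -> (forall x, D x -> 0 <= f x) ->
  (\int[mu]_(x in D) (f x)%:E < +oo)%E ->
  exists g : T -> R, [/\ measurable_fun D g, forall x, D x -> 0 <= g x <= f x &
    forall B, measurable B ->
      (\int[mu]_(x in B `&` D) (f x)%:E = \int[mu]_(x in B `&` D) (g x)%:E)%E].
Proof.
move=> mD f0 foo; have f0E x : D x -> (0 <= (f x)%:E)%E by rewrite lee_fin; exact: f0.
set I := (\int[mu]_(x in D) (f x)%:E)%E in foo *.
have I0 : (0 <= I)%E by exact: integral_ge0.
have Ifin : I \is a fin_num by rewrite ge0_fin_numE.
have approx k : exists h : {nnsfun T >-> R},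
    (forall x, (h x)%:E <= ((EFin \o f) \_ D) x)%E /\
    (I - (k.+1%:R^-1)%:E <= \int[mu]_(x in D) (h x)%:E)%E.
  have kp : 0 < k.+1%:R^-1 :> R by rewrite invr_gt0.
  pose S := [set sintegral mu h | h in
    [set h : {nnsfun T >-> R} | forall x, ((h x)%:E <= ((EFin \o f) \_ D) x)%E]].
  have IE : I = ereal_sup S by rewrite /I ge0_integralE.
  have := @ub_ereal_sup_adherent _ S _ kp; rewrite -IE => /(_ Ifin).
  move=> [_ [h hf <-]] Ih; exists h; split => //.
  apply: (le_trans (ltW Ih)); rewrite -integralT_nnsfun [leRHS]integral_mkcond.
  apply: ge0_le_lower_integral => x _; first by rewrite lee_fin.
  have := hf x; rewrite /patch; case: ifPn => // _.
have {approx}[h hP] := choice approx.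
have hf k x : D x -> h k x <= f x.
  by move=> Dx; have := (hP k).1 x; rewrite patchE mem_set.
pose g x := sups (fun k => h k x) 0%N.
have ub x : D x -> has_ubound (range (fun k => h k x)).
  by move=> Dx; exists (f x) => _ [k _ <-]; exact: hf.
have mg : measurable_fun D g.
  by apply: measurable_fun_sups => // k; exact: measurable_funTS.
have hg k x : D x -> h k x <= g x.
  move=> Dx; apply: ub_le_sup; last by exists k.
  by have [M hM] := ub _ Dx; exists M => _ [j _ <-]; apply: hM; exists j.
have g0 x : D x -> 0 <= g x by move=> Dx; apply: le_trans (hg 0%N x Dx).
have gf x : D x -> g x <= f x.
  by move=> Dx; apply: ge_sup; [exists (h 0%N x), 0%N|move=> _ [j _ <-]; exact: hf].
have g0E x : D x -> (0 <= (g x)%:E)%E by rewrite lee_fin; exact: g0.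
have mgE : measurable_fun D (EFin \o g) by exact/measurable_EFinP.
have intg : (\int[mu]_(x in D) (g x)%:E)%E = I.
  apply/eqP; rewrite eq_le; apply/andP; split.
    by apply: ge0_le_lower_integral => // x Dx; rewrite lee_fin gf.
  apply/lee_addgt0Pr => e e0.
  have [k ke] : exists k, k.+1%:R^-1 < e.
    have /cvgrPdist_lt /(_ _ e0) [k _ hk] := @cvg_harmonic R.
    exists k; have := hk k (leqnn k); rewrite /= sub0r normrN ger0_norm//.
  have := (hP k).2; rewrite leeBlDr// => hk; apply: (le_trans hk).
  apply: leeD; last by rewrite lee_fin ltW.
  by apply: ge0_le_lower_integral => x Dx; rewrite lee_fin// hg.
exists g; split => // [x Dx|B mB]; first by rewrite g0// gf.
apply/eqP; rewrite eq_le; apply/andP; split; last first.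
  by apply: ge0_le_lower_integral => x [_ Dx]; [exact: g0E|rewrite lee_fin gf].
have mBD : measurable (B `&` D) by exact: measurableI.
have mDB : measurable (D `\` B) by exact: measurableD.
have fBD x : (B `&` D) x -> (0 <= (f x)%:E)%E by move=> [_]; exact: f0E.
rewrite ge0_integralE//; apply: ge_ereal_sup => _ [u /= uf <-].
have split_g : (\int[mu]_(x in B `&` D) (g x)%:E + \int[mu]_(x in D `\` B) (g x)%:E = I)%E.
  rewrite -ge0_integral_setU//.
  - by rewrite (setIC B) setUIDK intg.
  - by rewrite (setIC B) setUIDK.
  - by move=> x; rewrite (setIC B) setUIDK; exact: g0E.
  - by apply/disj_setPS => x [[Bx _] [_]].
have fin2 : (\int[mu]_(x in D `\` B) (g x)%:E)%E \is a fin_num.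
  rewrite ge0_fin_numE; last by apply: integral_ge0 => x [Dx _]; exact: g0E.
  apply: le_lt_trans foo; rewrite -split_g leeDr//.
  by apply: integral_ge0 => x [_ Dx]; exact: g0E.
rewrite -(leeD2rE _ _ fin2) split_g -integralT_nnsfun.
have -> : (\int[mu]_x (u x)%:E = \int[mu]_(x in B `&` D) (u x)%:E)%E.
  rewrite [RHS]integral_mkcond; apply: eq_integral => x _.
  rewrite patchE; case: ifPn => // nx; apply/eqP; rewrite eq_le.
  have := uf x; rewrite patchE (negbTE nx) => ->; rewrite lee_fin; exact: fun_ge0.
have m1 : measurable_fun (B `&` D) (EFin \o u).
  by apply/measurable_EFinP; exact: measurable_funTS.
pose v x := if x \in B then (u x)%:E else (g x)%:E.
have -> : (\int[mu]_(x in B `&` D) (u x)%:E + \int[mu]_(x in D `\` B) (g x)%:E =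
   \int[mu]_(x in D) v x)%E.
  have mv : measurable_fun ((B `&` D) `|` (D `\` B)) v.
    apply/measurable_funU => //; split.
      apply: eq_measurable_fun m1 => x /set_mem[Bx _].
      by rewrite /v mem_set.
    apply: (@eq_measurable_fun _ _ _ _ _ (EFin \o g)).
      by move=> x /set_mem[_ nBx]; rewrite /v memNset.
    by apply: measurable_funS mgE => // x [].
  rewrite -[in RHS](setUIDK D B) (setIC D) ge0_integral_setU//.
  - congr (_ + _)%E; apply: eq_integral => x /set_mem[].
      by move=> Bx _; rewrite /v mem_set.
    by move=> _ nBx; rewrite /v memNset.
  - move=> x; rewrite (setIC B) setUIDK => Dx; rewrite /v; case: ifP => _.
      by rewrite lee_fin.
    exact: g0E.
  - by apply/disj_setPS => x [[Bx _] [_]].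
apply: ge0_le_lower_integral => x Dx; rewrite /v; case: ifPn => Bx.
- by rewrite lee_fin.
- exact: g0E.
- have := uf x; rewrite patchE mem_set//; split => //; exact: set_mem.
- by rewrite lee_fin gf.
Qed.

End measurable_minorant.

Lemma finite_measure_density d (T : measurableType d) (R : realType)
    (mu : {sigma_finite_measure set T -> \bar R}) (nu : {measure set T -> \bar R}) :
  (nu setT < +oo)%E -> nu `<< mu ->
  exists h : T -> R, [/\ measurable_fun setT h, forall x, 0 <= h x &
    forall B, measurable B -> (nu B = \int[mu]_(x in B) (h x)%:E)%E].
Proof.
move=> nuoo numu.
pose nuf : {finite_measure set T -> \bar R} := mfrestr measurableT nuoo.
have nufE B : nuf B = nu B by rewrite /nuf /= /mfrestr /mrestr setIT.
have numuf : nuf `<< mu.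
  apply/null_content_dominatesP => B mB B0; rewrite nufE.
  by move/null_content_dominatesP : numu; exact.
have [f [f0 ffin /integrableP[mf _] fE]] := radon_nikodym_sigma_finite numuf.
exists (fine \o f); split.
- exact: measurableT_comp.
- by move=> x; exact: fine_ge0.
- move=> B mB; rewrite -nufE fE ?inE//.
  by apply: eq_integral => x _ /=; rewrite fineK.
Qed.

Lemma bounded_densities d (T : measurableType d) (R : realType)
    (mu : {sigma_finite_measure set T -> \bar R})
    (nu1 nu2 : {measure set T -> \bar R}) (D : set T) (M : R) :
  measurable D -> (mu D < +oo)%E -> 0 <= M ->
  (forall B, measurable B -> (nu1 B + nu2 B <= M%:E * mu (B `&` D))%E) ->
  exists n1 n2 : T -> R, [/\ measurable_fun setT n1, measurable_fun setT n2,
    forall x, [/\ 0 <= n1 x, 0 <= n2 x & n1 x + n2 x <= M] &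
    forall B, measurable B -> (nu1 B = \int[mu]_(x in B `&` D) (n1 x)%:E)%E /\
                              (nu2 B = \int[mu]_(x in B `&` D) (n2 x)%:E)%E].
Proof.
move=> mD Doo M0 bnd.
have bnd1 B : measurable B -> (nu1 B <= M%:E * mu (B `&` D))%E.
  by move=> mB; apply: le_trans (bnd B mB); rewrite leeDl.
have bnd2 B : measurable B -> (nu2 B <= M%:E * mu (B `&` D))%E.
  by move=> mB; apply: le_trans (bnd B mB); rewrite leeDr.
have Moo : (M%:E * mu (setT `&` D) < +oo)%E.
  rewrite setTI lte_mul_pinfty// ?lee_fin//.
have null0 B : measurable B -> mu B = 0%E -> mu (B `&` D) = 0%E.
  move=> mB B0; apply/eqP; rewrite eq_le measure_ge0 andbT -B0.
  by apply: le_measure; rewrite ?inE//; exact: measurableI.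
have dom (nu : {measure set T -> \bar R}) :
    (forall B, measurable B -> (nu B <= M%:E * mu (B `&` D))%E) -> nu `<< mu.
  move=> nub; apply/null_content_dominatesP => B mB B0.
  apply/eqP; rewrite eq_le measure_ge0 andbT.
  by apply: le_trans (nub B mB) _; rewrite null0// mule0.
have [h1 [mh1 h10 h1E]] :=
  finite_measure_density (le_lt_trans (bnd1 _ measurableT) Moo) (dom _ bnd1).
have [h2 [mh2 h20 h2E]] :=
  finite_measure_density (le_lt_trans (bnd2 _ measurableT) Moo) (dom _ bnd2).
have mh : measurable_fun setT (h1 \+ h2) by exact: measurable_funD.
pose N : set T := [set x | M < h1 x + h2 x].
have mN : measurable N.
  rewrite /N -[X in measurable X]setTI.
  have := measurable_fun_ltr (@measurable_cst _ _ _ _ setT M) mh.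
  by move=> /(_ measurableT [set true] I).
have hE B : measurable B -> (nu1 B + nu2 B = \int[mu]_(x in B) (h1 x + h2 x)%:E)%E.
  move=> mB; rewrite h1E// h2E// -ge0_integralD//.
  - by move=> x _; rewrite lee_fin.
  - by apply/measurable_EFinP; exact: measurable_funTS.
  - by move=> x _; rewrite lee_fin.
  - by apply/measurable_EFinP; exact: measurable_funTS.
have N0 : mu (N `&` D) = 0%E.
  have mND : measurable (N `&` D) by exact: measurableI.
  have m2 : measurable_fun (N `&` D) (fun x => (h1 x + h2 x - M)%:E).
    by apply/measurable_EFinP/measurable_funTS/measurable_funB.
  have NDoo : (mu (N `&` D) < +oo)%E.
    by apply: le_lt_trans Doo; apply: le_measure; rewrite ?inE//; exact: subIsetr.
  have : (\int[mu]_(x in N `&` D) `|(h1 x + h2 x - M)%:E| = 0)%E.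
    have e1 : (\int[mu]_(x in N `&` D) `|(h1 x + h2 x - M)%:E| =
              \int[mu]_(x in N `&` D) (h1 x + h2 x - M)%:E)%E.
      apply: eq_integral => x /set_mem[Nx _]; rewrite gee0_abs// lee_fin.
      by rewrite subr_ge0 ltW.
    apply/eqP; rewrite eq_le integral_ge0 ?andbT; last by move=> x _; exact: abse_ge0.
    rewrite e1 -(leeD2rE _ _ (_ : (M%:E * mu (N `&` D))%E \is a fin_num)); last first.
      by rewrite fin_numM// ge0_fin_numE.
    rewrite add0e -integral_cst// -ge0_integralD//.
    + rewrite integral_cst//=.
      under eq_integral do rewrite -EFinD subrK.
      by rewrite -hE//; apply: le_trans (bnd _ mND) _; rewrite -setIA setIid.
    + by move=> x [Nx _]; rewrite lee_fin subr_ge0 ltW.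
  move=> /(ae_eq_integral_abs mu mND m2) [Z [mZ Z0 ZP]].
  apply/eqP; rewrite eq_le measure_ge0 andbT -Z0.
  apply: le_measure; rewrite ?inE// => x [Nx Dx]; apply: ZP => /= /(_ (conj Nx Dx)) [].
  by move/eqP; apply/negP; rewrite subr_eq0 gt_eqF.
pose c x := \1_(~` N) x : R.
have mc : measurable_fun setT c by exact/measurable_indic/measurableC.
have repr (nu : {measure set T -> \bar R}) h : 
    (forall B, measurable B -> (nu B <= M%:E * mu (B `&` D))%E) ->
    (forall B, measurable B -> (nu B = \int[mu]_(x in B) (h x)%:E)%E) ->
    forall B, measurable B -> (nu B = \int[mu]_(x in B `&` D) (h x * c x)%:E)%E.
  move=> nub nuE B mB.
  have mBDN : measurable (B `&` D `&` ~` N).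
    by apply: measurableI; [exact: measurableI|exact: measurableC].
  transitivity (nu (B `&` D `&` ~` N)).
    apply/eqP; rewrite eq_le; apply/andP; split; last first.
      by apply: le_measure; rewrite ?inE// => x [[]].
    have -> : B = (B `&` D `&` ~` N) `|` (B `\` (D `&` ~` N)) :> set T.
      by rewrite -setIA setUIDK.
    have mX : measurable (B `\` (D `&` ~` N)).
      by apply: measurableD => //; apply: measurableI => //; exact: measurableC.
    apply: (@le_trans _ _ (nu (B `&` D `&` ~` N) + nu (B `\` (D `&` ~` N)))%E).
      exact: measureU2.
    rewrite -[leRHS]adde0 -setIA setUIDK setIA leeD2l//.
    apply: le_trans (nub _ mX) _.
    have -> : mu ((B `\` (D `&` ~` N)) `&` D) = 0%E.
      apply/eqP; rewrite eq_le measure_ge0 andbT -N0.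
      apply: le_measure; rewrite ?inE//; try exact: measurableI.
      move=> x [[_ nDN] Dx]; split=> //.
      by apply: contrapT => nN; apply: nDN.
    by rewrite mule0.
  rewrite nuE// integral_mkcondr; apply: eq_integral => x _.
  rewrite patchE /c indicE; case: ifP => _; by rewrite ?mulr1 ?mulr0.
exists (fun x => h1 x * c x), (fun x => h2 x * c x); split.
- exact: measurable_funM.
- exact: measurable_funM.
- move=> x; rewrite /c indicE; case: (boolP (x \in ~` N)) => /= [/set_mem xN|_].
    by rewrite !mulr1; split=> //; rewrite leNgt; apply/negP.
  by rewrite !mulr0 addr0.
- by move=> B mB; split; apply: repr.
Qed.

Lemma density_measure_exists d (T : measurableType d) (R : realType)
    (mu : {measure set T -> \bar R}) (D : set T) (f : T -> R) :
  measurable D -> measurable_fun D f -> (forall x, D x -> 0 <= f x) ->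
  exists m : {measure set T -> \bar R}, forall B, measurable B ->
    m B = (\int[mu]_(x in B `&` D) (f x)%:E)%E.
Proof.
move=> mD mf f0.
pose m B := (\int[mu]_(x in B `&` D) (f x)%:E)%E.
have m0 : m set0 = 0%E by rewrite /m set0I integral_set0.
have m_ge0 B : (0 <= m B)%E.
  by apply: integral_ge0 => x [_ Dx]; rewrite lee_fin f0.
have m_add : semi_sigma_additive m.
  move=> /= F mF tF mUF; rewrite /m; apply: cvg_toP.
    apply: ereal_nondecreasing_is_cvgn => i n mn.
    by apply: lee_sum_nneg_natr => // k _ _; exact: m_ge0.
  rewrite setI_bigcupl ge0_integral_bigcup//=.
  - by move=> k; exact: measurableI.
  - apply/measurable_EFinP; apply: measurable_funS mf => //.
    by move=> x [k _ []].
  - by move=> x [k _ [_ Dx]]; rewrite lee_fin f0.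
  - exact: trivIset_setIr.
pose mm : {measure set T -> \bar R} := HB.pack m (isMeasure.Build _ _ _ m m0 m_ge0 m_add).
by exists mm.
Qed.

Lemma eq_couplings (R : realType) (a b : R) (f g f' g' : R -> R) :
  (forall B, measurable B -> (\int[lebesgue_measure]_(x in B `&` `]a, b[) (f x)%:E =
     \int[lebesgue_measure]_(x in B `&` `]a, b[) (f' x)%:E)%E) ->
  (forall B, measurable B -> (\int[lebesgue_measure]_(x in B `&` `]a, b[) (g x)%:E =
     \int[lebesgue_measure]_(x in B `&` `]a, b[) (g' x)%:E)%E) ->
  couplings a b f g = couplings a b f' g'.
Proof.
move=> ff gg; apply/seteqP; split=> gam /= h B mB.
  by rewrite -ff// -gg//; exact: h.
by rewrite ff// gg//; exact: h.
Qed.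

Lemma measurable_dist (R : realType) (p : nat) :
  measurable_fun setT (fun z : R * R => (`|z.1 - z.2| ^+ p)%:E).
Proof.
apply/measurable_EFinP; apply: measurable_funX.
apply: measurableT_comp => //; exact: measurable_funB.
Qed.

Lemma Wpp_ge0 (R : realType) (p : nat) (a b : R) (f g : R -> R) : (0 <= Wpp p a b f g)%E.
Proof.
apply: le_ereal_inf_tmp => _ [gam _ <-].
by apply: integral_ge0 => z _; rewrite lee_fin exprn_ge0.
Qed.

Lemma pushforward_exists d d' (T : measurableType d) (T' : measurableType d')
    (R : realType) (m : {measure set T -> \bar R}) (h : T -> T') :
  measurable_fun setT h -> exists m' : {measure set T' -> \bar R},
    (forall B, m' B = m (h @^-1` B)) /\
    (forall c : T' -> \bar R, measurable_fun setT c -> (forall z, (0 <= c z)%E) ->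
      (\int[m']_z c z = \int[m]_z c (h z))%E).
Proof.
move=> mh; unshelve refine (ex_intro _ (pushforward m h : {measure set T' -> \bar R}) _).
  exact: mh.
split => // c mc c0.
exact: (ge0_integral_pushforward mh m measurableT mc (fun z _ => c0 z)).
Qed.

Lemma Wpp_sym (R : realType) (p : nat) (a b : R) (f g : R -> R) :
  Wpp p a b f g = Wpp p a b g f.
Proof.
suff H f' g' : (Wpp p a b g' f' <= Wpp p a b f' g')%E by apply/eqP; rewrite eq_le !H.
apply: le_ereal_inf_tmp => _ [gam gamP <-].
have mswap : measurable_fun setT (fun z : R * R => (z.2, z.1)).
  exact: measurable_fun_pair.
have [gam' [gam'E gam'I]] := pushforward_exists gam mswap.
apply: ereal_inf_lbound; exists gam'.
  move=> B mB; rewrite !gam'E.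
  have -> : (fun z : R * R => (z.2, z.1)) @^-1` (B `*` setT) = setT `*` B.
    by apply/seteqP; split=> -[x y] /= [].
  have -> : (fun z : R * R => (z.2, z.1)) @^-1` (setT `*` B) = B `*` setT.
    by apply/seteqP; split=> -[x y] /= [].
  by split; [exact: (gamP B mB).2|exact: (gamP B mB).1].
rewrite gam'I.
- by apply: eq_integral => -[x y] _ /=; rewrite distrC.
- exact: measurable_dist.
- by move=> z; rewrite lee_fin exprn_ge0.
Qed.

Lemma Wpp_self (R : realType) (p : nat) (a b : R) (f : R -> R) :
  measurable_fun `]a, b[ f -> (forall x, a < x < b -> 0 <= f x) ->
  Wpp p.+1 a b f f = 0%E.
Proof.
move=> mf f0; apply/eqP; rewrite eq_le Wpp_ge0 andbT.
have [|m mE] := @density_measure_exists _ _ _ lebesgue_measure `]a, b[%classic f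
  (measurable_itv _) mf.
  by move=> x /=; rewrite in_itv/=; exact: f0.
have mdiag : measurable_fun setT (fun x : R => (x, x)).
  exact: measurable_fun_pair.
have [gam [gamE gamI]] := pushforward_exists m mdiag.
apply: ereal_inf_lbound; exists gam.
  move=> B mB; rewrite !gamE.
  have -> : (fun x : R => (x, x)) @^-1` (B `*` setT) = B.
    by apply/seteqP; split=> x /= => [[]|].
  have -> : (fun x : R => (x, x)) @^-1` (setT `*` B) = B.
    by apply/seteqP; split=> x /= => [[]|].
  by rewrite mE.
rewrite gamI.
- by apply: integral0_eq => x _ /=; rewrite subrr normr0 expr0n.
- exact: measurable_dist.
- by move=> z; rewrite lee_fin exprn_ge0.
Qed.

Lemma coupling_mass (R : realType) (a b : R) (f g : R -> R)
    (gam : {measure set (R * R)%type -> \bar R}) :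
  couplings a b f g gam -> mass a b f = mass a b g.
Proof.
move=> gamP; have [h1 h2] := gamP setT measurableT.
by move: h1 h2; rewrite !setTI /mass => <- <-.
Qed.

Definition transfer (R : realType) (A : set R) (e : R) (f n : R -> R) (x : R) : R :=
  (1 - e) * f x + e * (n x + f x * \1_(~` A) x).

(* A fraction [e] of the mass that [gam] couples to points of [A] is moved all
   the way to its target, where it costs nothing. *)
Lemma transfer_coupling (R : realType) (p : nat) (a b e : R) (f g n : R -> R)
    (A : set R) (gam : {measure set (R * R)%type -> \bar R}) :
  couplings a b f g gam -> measurable A -> 0 <= e <= 1 ->
  measurable_fun `]a, b[ f -> (forall x, a < x < b -> 0 <= f x) ->
  measurable_fun setT n -> (forall x, 0 <= n x) ->
  (forall B, measurable B ->
    gam (A `*` B) = \int[lebesgue_measure]_(x in B `&` `]a, b[) (n x)%:E)%E ->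
  exists2 gam', couplings a b (transfer A e f n) g gam' &
   (\int[gam']_z (`|z.1 - z.2| ^+ p)%:E <= \int[gam]_z (`|z.1 - z.2| ^+ p)%:E)%E.
Proof.
move=> gamP mA /andP[e0 e1] mf f0 mn n0 nE.
pose phi (z : R * R) := (z.1 + \1_A z.1 * (z.2 - z.1), z.2).
have mphi : measurable_fun setT phi.
  apply: measurable_fun_pair => //; apply: measurable_funD => //.
  apply: measurable_funM; last exact: measurable_funB.
  by apply: measurableT_comp => //; exact: measurable_indic.
have phiA z : A z.1 -> phi z = (z.2, z.2).
  by move=> Az; rewrite /phi indicE mem_set// mul1r addrC subrK.
have phiNA z : ~ A z.1 -> phi z = z.
  by move=> Az; rewrite /phi indicE memNset// mul0r addr0; case: z {Az}.
have [m [mE mI]] := pushforward_exists gam mphi.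
have e'0 : 0 <= 1 - e by rewrite subr_ge0.
pose m1 : {measure set (R * R)%type -> \bar R} := mscale (NngNum e'0) gam.
pose m2 : {measure set (R * R)%type -> \bar R} := mscale (NngNum e0) m.
pose gam' : {measure set (R * R)%type -> \bar R} := measure_add m1 m2.
have gam'E B : gam' B = ((1 - e)%:E * gam B + e%:E * gam (phi @^-1` B))%E.
  by rewrite -[LHS]/(measure_add m1 m2 B) measure_addE /= /mscale /= mE.
exists gam'; last first.
  have md := @measurable_dist R p.
  have d0 (z : R * R) : setT z -> (0 <= (`|z.1 - z.2| ^+ p)%:E)%E.
    by move=> _; rewrite lee_fin exprn_ge0.
  rewrite /gam' ge0_integral_measure_add// !ge0_integral_mscale//= mI//.
  have le2 : (\int[gam]_z (`|(phi z).1 - (phi z).2| ^+ p)%:E <=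
              \int[gam]_z (`|z.1 - z.2| ^+ p)%:E)%E.
    apply: ge0_le_lower_integral => z _; first by rewrite lee_fin exprn_ge0.
    rewrite lee_fin; have [Az|nAz] := pselect (A z.1); last by rewrite phiNA.
    by rewrite phiA//= subrr normr0 lerXn2r ?nnegrE.
  apply: (@le_trans _ _ ((1 - e)%:E * \int[gam]_z (`|z.1 - z.2| ^+ p)%:E +
     e%:E * \int[gam]_z (`|z.1 - z.2| ^+ p)%:E)%E).
    by rewrite leeD2l// lee_wpmul2l// lee_fin.
  rewrite -ge0_muleDl ?lee_fin// -EFinD subrK mul1e//.
move=> B mB; split; last first.
  rewrite gam'E.
  have -> : phi @^-1` (setT `*` B) = setT `*` B by apply/seteqP; split=> -[x y] /= [].
  rewrite -ge0_muleDl ?lee_fin// -EFinD subrK mul1e.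
  exact: (gamP B mB).2.
rewrite gam'E.
have mAc : measurable (~` A) by exact: measurableC.
have preE : phi @^-1` (B `*` setT) = (A `*` B) `|` ((B `&` ~` A) `*` setT).
  apply/seteqP; split=> z.
    rewrite /preimage /mkset; have [Az|nAz] := pselect (A z.1).
      by rewrite phiA// => -[Bz _]; left.
    by rewrite phiNA// => -[Bz _]; right.
  rewrite /preimage /mkset => -[[Az Bz]|[[Bz nAz] _]]; first by rewrite phiA.
  by rewrite phiNA.
have -> : gam (phi @^-1` (B `*` setT)) =
    (\int[lebesgue_measure]_(x in B `&` `]a, b[) (n x)%:E +
     \int[lebesgue_measure]_(x in B `&` ~` A `&` `]a, b[) (f x)%:E)%E.
  rewrite preE -(nE B mB) -(gamP _ (measurableI _ _ mB mAc)).1.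
  apply: measureU.
  - exact: measurableX.
  - by apply: measurableX => //; exact: measurableI.
  - by apply/seteqP; split=> -[x y]//= [[? ?] [[_]]].
rewrite (gamP B mB).1.
set D := B `&` `]a, b[%classic.
have mD : measurable D by exact: measurableI.
have Dab x : D x -> a < x < b by move=> [_]; rewrite /= in_itv.
have mfD : measurable_fun D f by apply: measurable_funS mf => // x [].
have mnD : measurable_fun D n by exact: measurable_funTS.
have mfA : measurable_fun D (fun x => f x * \1_(~` A) x).
  by apply: measurable_funM => //; apply/measurable_funTS/measurable_indic.
have fA0 x : D x -> 0 <= f x * \1_(~` A) x.
  by move=> Dx; rewrite mulr_ge0 ?f0 ?Dab// indicE.
have -> : (\int[lebesgue_measure]_(x in B `&` ~` A `&` `]a, b[) (f x)%:E =
   \int[lebesgue_measure]_(x in D) (f x * \1_(~` A) x)%:E)%E.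
  rewrite setIAC integral_mkcondr; apply: eq_integral => x _.
  by rewrite patchE indicE; case: ifP; rewrite ?mulr1 ?mulr0.
have f0E x : D x -> (0 <= (f x)%:E)%E by move=> Dx; rewrite lee_fin f0// Dab.
have n0E x : D x -> (0 <= (n x)%:E)%E by move=> Dx; rewrite lee_fin.
have fA0E x : D x -> (0 <= (f x * \1_(~` A) x)%:E)%E by move=> Dx; rewrite lee_fin fA0.
have mfE : measurable_fun D (fun x => (f x)%:E) by exact/measurable_EFinP.
have mnE : measurable_fun D (fun x => (n x)%:E) by exact/measurable_EFinP.
have mfAE : measurable_fun D (fun x => (f x * \1_(~` A) x)%:E) by exact/measurable_EFinP.
have mS := emeasurable_funD mnE mfAE.
have S0 x : D x -> (0 <= (n x)%:E + (f x * \1_(~` A) x)%:E)%E.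
  by move=> Dx; rewrite adde_ge0// ?n0E ?fA0E.
rewrite -ge0_integralD// -ge0_integralZl ?lee_fin// -ge0_integralZl ?lee_fin//.
rewrite -ge0_integralD//.
- by move=> x Dx; rewrite mule_ge0 ?lee_fin// f0// Dab.
- exact: emeasurable_funM.
- by move=> x Dx; apply: mule_ge0; [rewrite lee_fin|exact: S0].
- exact: emeasurable_funM.
Qed.

Section integrable_real.
Context d (T : measurableType d) (R : realType).
Variables (mu : {measure set T -> \bar R}) (D : set T).
Hypothesis mD : measurable D.
Implicit Types f g : T -> R.

Lemma integrable_EFinD f g : mu.-integrable D (EFin \o f) ->
  mu.-integrable D (EFin \o g) -> mu.-integrable D (EFin \o (fun x => f x + g x)).
Proof. exact: integrableD. Qed.

Lemma integrable_EFinB f g : mu.-integrable D (EFin \o f) ->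
  mu.-integrable D (EFin \o g) -> mu.-integrable D (EFin \o (fun x => f x - g x)).
Proof. exact: integrableB. Qed.

Lemma integrable_EFinZ k f : mu.-integrable D (EFin \o f) ->
  mu.-integrable D (EFin \o (fun x => k * f x)).
Proof. exact: integrableZl. Qed.

Lemma integrable_squeeze (u f v : T -> R) :
  measurable_fun D f -> (forall x, D x -> u x <= f x <= v x) ->
  mu.-integrable D (EFin \o u) -> mu.-integrable D (EFin \o v) ->
  mu.-integrable D (EFin \o f).
Proof.
move=> mf ufv iu iv.
apply: (@le_integrable _ _ _ mu D mD _ (EFin \o (fun x => `|u x| + `|v x|))).
- exact/measurable_EFinP.
- move=> x Dx; have /andP[uf fv] := ufv x Dx.
  rewrite /= lee_fin [leRHS]ger0_norm ?addr_ge0// ler_norml; apply/andP; split.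
    by have := ler_norm (- u x); rewrite normrN; have := normr_ge0 (v x); lra.
  by have := ler_norm (v x); have := normr_ge0 (u x); lra.
- exact: integrable_EFinD (integrable_norm iu) (integrable_norm iv).
Qed.

Lemma integrable_lbound f (c : R) : (mu D < +oo)%E -> measurable_fun D f ->
  (forall x, D x -> c <= f x) -> (\int[mu]_(x in D) (f x)%:E < +oo)%E ->
  mu.-integrable D (EFin \o f).
Proof.
move=> Doo mf cf foo.
have mfE : measurable_fun D (EFin \o f) by exact/measurable_EFinP.
have negoo : (\int[mu]_(x in D) ((EFin \o f)^\- x) < +oo)%E.
  apply: (@le_lt_trans _ _ (\int[mu]_(x in D) (cst `|c|%:E x))%E).
    apply: ge0_le_lower_integral => x Dx.
      exact: funeneg_ge0.
    rewrite funenegE /= ge_max !lee_fin normr_ge0 andbT.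
    by have := ler_norm (- c); rewrite normrN; have := cf x Dx; lra.
  by rewrite integral_cst// lte_mul_pinfty// lee_fin.
have posoo : (\int[mu]_(x in D) ((EFin \o f)^\+ x) < +oo)%E.
  have negfin : (\int[mu]_(x in D) ((EFin \o f)^\- x))%E \is a fin_num.
    by rewrite ge0_fin_numE// integral_ge0.
  by move: foo; rewrite integralE lteBlDr// => /lt_le_trans; apply; rewrite leey.
apply/integrableP; split => //.
rewrite -[fun x => _]/(abse \o (EFin \o f)) fune_abse ge0_integralD//.
- by rewrite lte_add_pinfty.
- exact: measurable_funepos.
- exact: measurable_funeneg.
Qed.

End integrable_real.

Lemma measurable_density_comp (R : realType) d (T : measurableType d) (chi : R -> R)
    (D : set T) (s : T -> R) :
  internal_energy_density chi -> measurable D -> measurable_fun D s ->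
  (forall x, D x -> 0 <= s x) -> measurable_fun D (chi \o s).
Proof.
move=> [cchi _] mD ms s0.
apply: (@measurable_comp _ _ _ _ _ _ (`[0, +oo[%classic : set R)) => //.
- by move=> _ [x Dx <-] /=; rewrite in_itv/= s0.
- exact: subspace_continuous_measurable_fun.
Qed.

Lemma itvoo_measure (R : realType) (a b : R) : a < b ->
  lebesgue_measure (`]a, b[%classic : set R) = (b - a)%:E.
Proof. by move=> ab; rewrite lebesgue_measure_itv/= lte_fin ab EFinB. Qed.

Lemma integrable_cst_itv (R : realType) (a b k : R) : a < b ->
  lebesgue_measure.-integrable `]a, b[ (EFin \o cst k).
Proof.
move=> ab; apply/integrableP; split; first by apply/measurable_EFinP; exact: measurable_cst.
rewrite /= integral_cst//=.
by rewrite itvoo_measure// -EFinM ltry.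
Qed.

Lemma Rintegral_cst_itv (R : realType) (a b k : R) : a < b ->
  Rintegral lebesgue_measure `]a, b[ (fun=> k) = k * (b - a).
Proof. by move=> ab; rewrite Rintegral_cst//= itvoo_measure. Qed.

Local Notation leb := (@lebesgue_measure _).

Lemma integrable_excess (R : realType) (a b M : R) (chi s : R -> R) :
  a < b -> internal_energy_density chi -> 0 < M ->
  (forall x, a < x < b -> 0 <= s x) ->
  leb.-integrable `]a, b[ (EFin \o s) ->
  leb.-integrable `]a, b[ (EFin \o (fun x => chi (s x))) ->
  leb.-integrable `]a, b[
    (EFin \o (fun x => if M < s x then bregman chi M (s x) else 0)).
Proof.
move=> ab hchi M0 s0 is_ ichis.
pose K x := if M < s x then bregman chi M (s x) else 0.
set Om := `]a, b[%classic.
have mOm : measurable (Om : set R) by exact: measurable_itv.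
have s0' x : Om x -> 0 <= s x by rewrite /Om /= in_itv; exact: s0.
have mRE h : leb.-integrable Om (EFin \o h) -> measurable_fun Om h.
  by move=> /integrableP[/measurable_EFinP].
have ms := mRE _ is_.
have ibreg : leb.-integrable Om (EFin \o (fun x => bregman chi M (s x))).
  have icst k := @integrable_cst_itv R a b k ab.
  apply: integrable_EFinB => //; first exact: integrable_EFinB ichis (icst (chi M)).
  by apply: integrable_EFinZ => //; exact: integrable_EFinB is_ (icst M).
have K0 x : Om x -> 0 <= K x.
  by move=> Ox; rewrite /K; case: ifP => // _; apply: bregman_ge0 => //; exact: s0'.
have mK : measurable_fun Om K.
  have mlt : measurable_fun Om (fun x => M < s x).
    exact: (measurable_fun_ltr (measurable_cst _) ms).
  apply: (measurable_fun_if mOm mlt); last exact: measurable_cst.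
  by apply: measurable_funS (mRE _ ibreg) => //; exact: subIsetl.
apply: (@integrable_squeeze _ _ _ leb Om mOm (cst 0) K (fun x => bregman chi M (s x)));
  [exact: mK| |exact: integrable_cst_itv|exact: ibreg] => x Ox.
rewrite K0//= /K; case: ifP => // _; apply: bregman_ge0 => //; exact: s0'.
Qed.

Lemma energy_transfer (R : realType) (a b M e : R) (chi f g n1 n2 : R -> R)
    (A : set R) :
  a < b -> internal_energy_density chi -> 0 < M -> 0 < e < 1 ->
  (forall x, a < x < b -> 0 <= f x /\ 0 <= g x) ->
  (forall x, [/\ 0 <= n1 x, 0 <= n2 x & n1 x + n2 x <= M]) ->
  (forall x, a < x < b -> A x <-> M < f x + g x) ->
  let fe := transfer A e f n1 in let ge := transfer A e g n2 in
  leb.-integrable `]a, b[ (EFin \o f) -> leb.-integrable `]a, b[ (EFin \o g) ->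
  leb.-integrable `]a, b[ (EFin \o fe) -> leb.-integrable `]a, b[ (EFin \o ge) ->
  mass a b fe = mass a b f -> mass a b ge = mass a b g ->
  leb.-integrable `]a, b[ (fun x => (chi (f x + g x))%:E) ->
  (energy a b chi fe ge <= energy a b chi f g +
    ((bregman chi M (M + e * M) + bregman chi M (M - e * M)) * (b - a) -
      e * Rintegral leb `]a, b[
        (fun x => if M < f x + g x then bregman chi M (f x + g x) else 0%R))%:E)%E.
Proof.
move=> ab hchi M0 e01 fg0 n0 AE fe ge if_ ig ife ige mfe mge ichi.
have /andP[e0 e1] := e01.
set th := bregman chi M (M + e * M) + _; pose s x := f x + g x; pose se x := fe x + ge x.
pose K x := if M < s x then bregman chi M (s x) else 0.
set Om := `]a, b[%classic.
have mOm : measurable Om by exact: measurable_itv.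
have Omab x : Om x -> a < x < b by rewrite /Om /= in_itv.
have s0 x : Om x -> 0 <= s x by move=> /Omab/fg0[? ?]; rewrite addr_ge0.
have is_ : leb.-integrable Om (EFin \o s) by exact: integrable_EFinD.
have ise : leb.-integrable Om (EFin \o se) by exact: integrable_EFinD.
have mRE h : leb.-integrable Om (EFin \o h) -> measurable_fun Om h.
  by move=> /integrableP[/measurable_EFinP].
have seE x : Om x -> se x = if M < s x then (1 - e) * s x + e * (n1 x + n2 x)
                            else s x + e * (n1 x + n2 x).
  move=> Ox; rewrite /se /fe /ge /transfer indicE.
  case: ltP => Ms; [rewrite memNset | rewrite mem_set].
  - by rewrite /= /s; ring.
  - by move=> /=; apply; apply/AE => //; exact: Omab.
  - by rewrite /= /s; ring.
  - by move=> /AE -/(_ (Omab _ Ox)); rewrite ltNge => /negP; apply.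
have se0 x : Om x -> 0 <= se x.
  move=> Ox; have [n10 n20 _] := n0 x; rewrite seE//.
  have s0x := s0 x Ox; have n120 := addr_ge0 n10 n20.
  by case: ifP => _; rewrite addr_ge0 ?mulr_ge0 ?subr_ge0 ?(ltW e0) ?(ltW e1).
have pw x : Om x -> chi (se x) + e * K x <=
    chi (s x) + (derive1 chi M * (se x - s x) + th).
  move=> Ox; have [n10 n20 n12] := n0 x.
  have n12' : 0 <= n1 x + n2 x <= M by rewrite addr_ge0.
  have := bregman_transfer hchi M0 (s0 x Ox) n12' e01; rewrite -seE// -/th /K.
  have -> : (if M < s x then e * bregman chi M (s x) else 0) =
            e * (if M < s x then bregman chi M (s x) else 0).
    by case: ifP; rewrite ?mulr0.
  move: (e * _) => z; rewrite /bregman; lra.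
have ms := mRE _ is_.
have ichis : leb.-integrable Om (EFin \o (fun x => chi (s x))) by exact: ichi.
have mchis : measurable_fun Om (fun x => chi (s x)) := measurable_density_comp hchi mOm ms s0.
have mchise : measurable_fun Om (fun x => chi (se x)) :=
  measurable_density_comp hchi mOm (mRE _ ise) se0.
have ith : leb.-integrable Om (EFin \o (fun x => derive1 chi M * (se x - s x) + th)).
  by apply: integrable_EFinD (integrable_cst_itv _ ab) => //;
    apply: integrable_EFinZ => //; exact: integrable_EFinB.
have irhs : leb.-integrable Om
    (EFin \o (fun x => chi (s x) + (derive1 chi M * (se x - s x) + th))).
  exact: integrable_EFinD.
have K0 x : Om x -> 0 <= K x.
  by move=> Ox; rewrite /K; case: ifP => // _; apply: bregman_ge0 => //; exact: s0.
have iK : leb.-integrable Om (EFin \o K).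
  by apply: integrable_excess => // x xab; apply: s0; rewrite /Om /= in_itv.
have ieK : leb.-integrable Om (EFin \o (fun x => e * K x)) by exact: integrable_EFinZ.
have ichise : leb.-integrable Om (EFin \o (fun x => chi (se x))).
  apply: (@integrable_squeeze _ _ _ leb Om mOm (cst (chi 0)) _
    (fun x => chi (s x) + (derive1 chi M * (se x - s x) + th)));
    [exact: mchise| |exact: integrable_cst_itv|exact: irhs] => x Ox.
  rewrite (density_nd hchi) ?se0//=; apply: le_trans (pw x Ox).
  by rewrite lerDl mulr_ge0 ?K0// ltW.
have Eint h : leb.-integrable Om (EFin \o h) ->
   (\int[leb]_(x in Om) (h x)%:E = (Rintegral leb Om h)%:E)%E.
  by move=> ih; rewrite /Rintegral fineK//; exact: integrable_fin_num.
rewrite /energy -/Om (Eint _ ichis) (Eint _ ichise) -EFinD lee_fin.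
have eqs : Rintegral leb Om se = Rintegral leb Om s.
  have -> : Rintegral leb Om se = Rintegral leb Om fe + Rintegral leb Om ge.
    exact: RintegralD.
  have -> : Rintegral leb Om s = Rintegral leb Om f + Rintegral leb Om g.
    exact: RintegralD.
  congr (_ + _).
    by rewrite /Rintegral; congr fine; exact: mfe.
  by rewrite /Rintegral; congr fine; exact: mge.
have isum : leb.-integrable Om (EFin \o (fun x => chi (se x) + e * K x)).
  exact: integrable_EFinD.
have := @le_Rintegral _ _ _ leb Om _ _ mOm isum irhs pw.
have idiff : leb.-integrable Om (EFin \o (fun x => se x - s x)) by exact: integrable_EFinB.
have icd : leb.-integrable Om (EFin \o (fun x => derive1 chi M * (se x - s x))).
  exact: integrable_EFinZ.
rewrite RintegralD// RintegralD// [X in _ <= _ + X](_ : _ =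
    Rintegral leb Om (fun x => derive1 chi M * (se x - s x)) +
    Rintegral leb Om (fun=> th)); last first.
  by apply: RintegralD => //; exact: integrable_cst_itv.
rewrite !RintegralZl// RintegralB// eqs subrr mulr0 Rintegral_cst_itv// add0r /K /s.
by rewrite -lerBrDr addrA.
Qed.

Lemma admissible_fin_num (R : realType) (a b : R) (m : \bar R) (f : R -> R) :
  admissible a b m f -> m \is a fin_num.
Proof.
move=> [_ [if_ <-]]; rewrite /mass; apply: integrable_fin_num => //.
Qed.

Lemma coupling_slice (R : realType) (A : set R)
    (gam : {measure set (R * R)%type -> \bar R}) : measurable A ->
  exists nu : {measure set (measurableTypeR R) -> \bar R}, forall B, nu B = gam (A `*` B).
Proof.
move=> mA; have mAT : measurable (A `*` [set: R]) by exact: measurableX.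
have msnd : measurable_fun setT (snd : R * R -> measurableTypeR R) by exact: measurable_snd.
have [nu [nuE _]] := pushforward_exists (mrestr gam mAT) msnd.
exists nu => B; rewrite nuE /= /mrestr; congr (gam _).
by apply/seteqP; split=> -[x y] /= => [[? []]|[]].
Qed.

Lemma measurable_transfer (R : realType) (D A : set R) (e : R) (f n : R -> R) :
  measurable A -> measurable_fun D f -> measurable_fun setT n ->
  measurable_fun D (transfer A e f n).
Proof.
move=> mA mf mn; have mc k : measurable_fun D (cst k : R -> R) by exact: measurable_cst.
apply: measurable_funD; first exact: measurable_funM.
apply: measurable_funM => //; apply: measurable_funD; first exact: measurable_funTS.
apply: measurable_funM => //; apply/measurable_funTS/measurable_indic.
exact: measurableC.
Qed.

Lemma transfer_ge0 (R : realType) (A : set R) (e : R) (f n : R -> R) (x : R) :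
  0 <= e <= 1 -> 0 <= f x -> 0 <= n x -> 0 <= transfer A e f n x.
Proof.
move=> /andP[e0 e1] f0 n0; rewrite /transfer indicE.
by rewrite addr_ge0// mulr_ge0 ?subr_ge0// addr_ge0// mulr_ge0.
Qed.

Lemma transfer_admissible (R : realType) (a b e : R) (f g n : R -> R) (A : set R)
    (gam : {measure set (R * R)%type -> \bar R}) :
  a < b -> 0 <= e <= 1 -> measurable A -> admissible a b (mass a b g) f ->
  measurable_fun setT n -> (forall x, 0 <= n x) ->
  couplings a b (transfer A e f n) g gam ->
  admissible a b (mass a b g) (transfer A e f n).
Proof.
move=> ab e01 mA [f0 [if_ fg]] mn n0 gamP.
have fe0 x : a < x < b -> 0 <= transfer A e f n x.
  by move=> xab; apply: transfer_ge0 => //; exact: f0.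
have mf : measurable_fun (`]a, b[%classic : set R) f.
  by have /integrableP[/measurable_EFinP] := if_.
split; [exact: fe0|split; last exact: coupling_mass gamP].
apply: (@integrable_lbound _ _ _ leb `]a, b[%classic _ _ 0).
- exact: measurable_itv.
- by rewrite /= itvoo_measure// ltry.
- exact: measurable_transfer.
- by move=> x /=; rewrite in_itv/=; exact: fe0.
- have -> : (\int[leb]_(x in `]a, b[) (transfer A e f n x)%:E = mass a b f)%E.
    by rewrite fg; exact: coupling_mass gamP.
  by have := admissible_fin_num (conj f0 (conj if_ fg)); rewrite -fg fin_numElt => /andP[].
Qed.

Lemma Wpp_adherent (R : realType) (p : nat) (a b : R) (f g : R -> R) (d : R) :
  0 < d -> (Wpp p a b f g < +oo)%E -> exists2 gam, couplings a b f g gam &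
  (\int[gam]_z (`|z.1 - z.2| ^+ p)%:E <= Wpp p a b f g + d%:E)%E.
Proof.
move=> d0 Woo.
have Wfin : Wpp p a b f g \is a fin_num by rewrite ge0_fin_numE// Wpp_ge0.
have [_ [gam gamP <-] h] := lb_ereal_inf_adherent d0 Wfin.
by exists gam => //; exact: ltW.
Qed.

Lemma JKO_max_principle (R : realType) (a b tau M : R) (chi ph eh f g : R -> R) :
  a < b -> 0 < tau -> internal_energy_density chi -> 0 < M ->
  (forall B, measurable B ->
    (\int[leb]_(x in B `&` `]a, b[) (ph x)%:E +
     \int[leb]_(x in B `&` `]a, b[) (eh x)%:E <= M%:E * leb (B `&` `]a, b[%classic))%E) ->
  admissible a b (mass a b ph) f -> admissible a b (mass a b eh) g ->
  (forall p e, admissible a b (mass a b ph) p -> admissible a b (mass a b eh) e ->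
    (JKO_functional a b tau chi ph eh f g <= JKO_functional a b tau chi ph eh p e)%E) ->
  (Wpp 2 a b f ph < +oo)%E -> (Wpp 2 a b g eh < +oo)%E ->
  (energy a b chi f g < +oo)%E ->
  {ae leb, forall x, a < x < b -> f x + g x <= M}.
Proof.
move=> ab tau0 hchi M0 bnd af ag fgmin W1oo W2oo Eoo.
have [f0 [if_ mf_]] := af; have [g0 [ig mg_]] := ag.
set Om := `]a, b[%classic.
have mOm : measurable (Om : set R) by exact: measurable_itv.
have Omoo : (leb Om < +oo)%E by rewrite /Om /= itvoo_measure// ltry.
have Omab x : Om x -> a < x < b by rewrite /Om /= in_itv.
have mf : measurable_fun Om f by have /integrableP[/measurable_EFinP] := if_.
have mg : measurable_fun Om g by have /integrableP[/measurable_EFinP] := ig.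
have mfg : measurable_fun Om (fun x => f x + g x) by exact: measurable_funD.
have fg0 x : Om x -> 0 <= f x + g x by move=> /Omab xab; rewrite addr_ge0 ?f0 ?g0.
have mchi := measurable_density_comp hchi mOm mfg fg0.
have ichi : leb.-integrable Om (EFin \o (fun x => chi (f x + g x))).
  apply: (@integrable_lbound _ _ _ leb Om mOm _ (chi 0)) => //.
  by move=> x Ox; apply: density_nd => //; exact: fg0.
pose K x := if M < f x + g x then bregman chi M (f x + g x) else 0.
pose I := Rintegral leb Om K.
have mlt : measurable_fun Om (fun x => M < f x + g x).
  exact: (measurable_fun_ltr (measurable_cst _) mfg).
pose A := Om `&` [set x | M < f x + g x].
have mA : measurable A by exact: (mlt mOm [set true] Logic.I).
have AP x : a < x < b -> A x <-> M < f x + g x.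
  by move=> xab; split=> [[]//|Mx]; split=> //; rewrite /Om /= in_itv.
have W1fin : Wpp 2 a b f ph \is a fin_num by rewrite ge0_fin_numE// Wpp_ge0.
have W2fin : Wpp 2 a b g eh \is a fin_num by rewrite ge0_fin_numE// Wpp_ge0.
have Efin : energy a b chi f g \is a fin_num by apply: integrable_fin_num ichi.
have perturb e d : 0 < e < 1 -> 0 < d -> e * I <=
    (bregman chi M (M + e * M) + bregman chi M (M - e * M)) * (b - a) + d.
  move=> e01 d0; have /andP[e0 e1] := e01.
  have e01' : 0 <= e <= 1 by rewrite !ltW.
  have dt0 : 0 < d * tau by rewrite mulr_gt0.
  have [gam1 gam1P c1] := Wpp_adherent dt0 W1oo.
  have [gam2 gam2P c2] := Wpp_adherent dt0 W2oo.
  have [nu1 nu1E] := coupling_slice gam1 mA.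
  have [nu2 nu2E] := coupling_slice gam2 mA.
  have slice_le (gam : {measure set (R * R)%type -> \bar R}) B : measurable B ->
      (gam (A `*` B) <= gam (setT `*` B))%E.
    move=> mB; apply: le_measure; rewrite ?inE; try exact: measurableX.
    by move=> z [].
  have [|n1 [n2 [mn1 mn2 n12 n12E]]] :=
    @bounded_densities _ _ R leb nu1 nu2 Om M mOm Omoo (ltW M0).
    move=> B mB; rewrite nu1E nu2E; apply: le_trans (bnd B mB).
    by rewrite -(gam1P B mB).2 -(gam2P B mB).2 leeD// slice_le.
  have n10 x : 0 <= n1 x by case: (n12 x).
  have n20 x : 0 <= n2 x by case: (n12 x).
  have n1E B : measurable B -> (gam1 (A `*` B) = \int[leb]_(x in B `&` Om) (n1 x)%:E)%E.
    by move=> mB; rewrite -nu1E; exact: (n12E B mB).1.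
  have n2E B : measurable B -> (gam2 (A `*` B) = \int[leb]_(x in B `&` Om) (n2 x)%:E)%E.
    by move=> mB; rewrite -nu2E; exact: (n12E B mB).2.
  have [gam1' gam1'P c1'] := transfer_coupling 2 gam1P mA e01' mf f0 mn1 n10 n1E.
  have [gam2' gam2'P c2'] := transfer_coupling 2 gam2P mA e01' mg g0 mn2 n20 n2E.
  have afe := transfer_admissible ab e01' mA af mn1 n10 gam1'P.
  have age := transfer_admissible ab e01' mA ag mn2 n20 gam2'P.
  have := fgmin _ _ afe age; have [_ [ife mfe]] := afe; have [_ [ige mge]] := age.
  have fg0' x : a < x < b -> 0 <= f x /\ 0 <= g x by move=> xab; rewrite f0 ?g0.
  have := energy_transfer ab hchi M0 e01 fg0' n12 AP if_ ig ife ige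
    (etrans mfe (esym mf_)) (etrans mge (esym mg_)) ichi.
  rewrite -/Om -/K -/I.
  set fe := transfer A e f n1; set ge := transfer A e g n2.
  set th := bregman chi M (M + e * M) + _.
  have W1' : (Wpp 2 a b fe ph <= Wpp 2 a b f ph + (d * tau)%:E)%E.
    by apply: le_trans (le_trans c1' c1); apply: ereal_inf_lbound; exists gam1'.
  have W2' : (Wpp 2 a b ge eh <= Wpp 2 a b g eh + (d * tau)%:E)%E.
    by apply: le_trans (le_trans c2' c2); apply: ereal_inf_lbound; exists gam2'.
  move=> Ele Jle.
  have {Jle}Jle : (JKO_functional a b tau chi ph eh f g <=
     ((2 * tau)^-1)%:E * ((Wpp 2 a b f ph + (d * tau)%:E) + (Wpp 2 a b g eh + (d * tau)%:E))
      + (energy a b chi f g + (th * (b - a) - e * I)%:E))%E.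
    apply: le_trans Jle _; apply: leeD => //.
    by rewrite lee_wpmul2l ?lee_fin ?invr_ge0 ?mulr_ge0 ?(ltW tau0)// leeD.
  move: Jle; rewrite /JKO_functional.
  rewrite -(fineK W1fin) -(fineK W2fin) -(fineK Efin) -!EFinD lee_fin.
  move: (fine _) (fine _) (fine _) => E w2 w1.
  have -> : (2 * tau)^-1 * (w1 + d * tau + (w2 + d * tau)) =
            (2 * tau)^-1 * (w1 + w2) + d by field; rewrite gt_eqF.
  by lra.
have I0 : I <= 0.
  apply/ler_addgt0Pr => d d0; rewrite add0r.
  have ba0 : 0 < b - a by rewrite subr_gt0.
  have d'0 : 0 < d / (2 * (b - a)) by rewrite divr_gt0// mulr_gt0.
  have [e e01 he] := bregman_littleo hchi M0 d'0; have /andP[e0 e1] := e01.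
  have d20 : 0 < e * d / 2 by rewrite divr_gt0// mulr_gt0.
  have := perturb e _ e01 d20.
  have := ler_wpM2r (ltW ba0) he.
  have -> : d / (2 * (b - a)) * e * (b - a) = e * d / 2 by field; rewrite gt_eqF.
  move=> h1 h2; rewrite -(ler_pM2l e0); lra.
have iK : leb.-integrable Om (EFin \o K).
  have ifg : leb.-integrable Om (EFin \o (fun x => f x + g x)) by exact: integrable_EFinD.
  by apply: integrable_excess => // x xab; rewrite addr_ge0 ?f0 ?g0.
have K0 x : Om x -> 0 <= K x.
  by move=> Ox; rewrite /K; case: ifP => // _; apply: bregman_ge0 => //; exact: fg0.
have mKE : measurable_fun Om (EFin \o K) by have /integrableP[] := iK.
have : (\int[leb]_(x in Om) `|(EFin \o K) x| = 0)%E.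
  have -> : (\int[leb]_(x in Om) `|(EFin \o K) x| = \int[leb]_(x in Om) (K x)%:E)%E.
    by apply: eq_integral => x /set_mem Ox; rewrite gee0_abs// lee_fin K0.
  have -> : (\int[leb]_(x in Om) (K x)%:E = I%:E)%E.
    by rewrite /I /Rintegral fineK//; exact: (integrable_fin_num _ iK).
  by congr EFin; apply/eqP; rewrite eq_le I0/=; exact: Rintegral_ge0.
move=> /(ae_eq_integral_abs leb mOm mKE); apply: filterS => x /= Kx0 xab.
have Ox : Om x by rewrite /Om /= in_itv.
have := Kx0 Ox; rewrite leNgt => -[Kx]; apply/negP => Mx.
move: Kx; rewrite /K Mx; apply/eqP; rewrite gt_eqF//.
by rewrite -(bregmanxx chi M); exact: bregman_incr.
Qed.

Lemma gronwall_multiplicative (R : realType) (tau C : R) (s g : R -> R) :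
  0 <= tau -> {within `[0, tau], continuous s} ->
  (forall t, 0 < t < tau -> 0 <= s t) ->
  (forall t, 0 < t < tau -> is_derive t 1 s (s t * g t)) ->
  (forall t, 0 < t < tau -> g t <= C) ->
  s tau <= expR (C * tau) * s 0.
Proof.
move=> tau0 cs s0 ds gC.
pose u t := s t * expR (- C * t).
have du t : 0 < t < tau ->
    is_derive t 1 u (expR (- C * t) * (s t * g t - C * s t)).
  move=> tt; have ds' := ds t tt.
  have de : is_derive t 1 (fun t => expR (- C * t)) (- C * expR (- C * t)).
    have dl : is_derive t 1 (fun t => - C * t) (- C).
      by apply: is_derive_eq; rewrite scaler1.
    by have := is_derive1_comp (is_derive_expR (- C * t)) dl; rewrite mulrC.
  rewrite /u; apply: is_derive_eq.
  rewrite /GRing.scale/=; ring.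
have cu : {within `[0, tau], continuous u}.
  move=> x; apply: cvgM; first exact: cs.
  apply: (@continuous_subspaceT _ _ _ (fun t => expR (- C * t))) => y.
  apply: continuous_comp; last exact: continuous_expR.
  by apply: cvgM; [exact: cvg_cst|exact: cvg_id].
have -> : s tau = expR (C * tau) * u tau.
  by rewrite /u mulrCA -expRD mulNr addrN expR0 mulr1.
rewrite ler_pM2l ?expR_gt0//.
have -> : s 0 = u 0 by rewrite /u mulr0 expR0 mulr1.
apply: (@ler0_derive1_nincr _ u 0 tau) => // x; rewrite in_itv/= => xt.
  by have [] := du x xt.
have [_ dE] := du x xt; rewrite derive1E dE.
rewrite pmulr_rle0 ?expR_gt0// subr_le0 mulrC ler_wpM2r ?s0 ?gC//.
Qed.

Lemma expR_sub1_le (R : realType) (x : R) : expR x - 1 <= x * expR x.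
Proof.
have := expR_ge1Dx (- x); rewrite expRN => h.
have e0 := expR_gt0 x.
have := ler_wpM2r (ltW e0) h; rewrite mulVf ?gt_eqF// mulrDl mul1r mulNr.
by lra.
Qed.

Lemma ae_imply d (T : measurableType d) (R : realType)
    (mu : {measure set T -> \bar R}) (P Q : T -> Prop) :
  (forall x, P x -> Q x) -> {ae mu, forall x, P x} -> {ae mu, forall x, Q x}.
Proof. by move=> PQ; exact: filterS. Qed.

Lemma ae_le_integral_lbound d (T : measurableType d) (R : realType)
    (mu : {measure set T -> \bar R}) (D : set T) (f g : T -> R) (c : R) :
  measurable D -> (mu D < +oo)%E -> measurable_fun D f ->
  (forall x, D x -> c <= f x) -> mu.-integrable D (EFin \o g) ->
  {ae mu, forall x, D x -> f x <= g x} ->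
  (\int[mu]_(x in D) (f x)%:E <= \int[mu]_(x in D) (g x)%:E)%E.
Proof.
move=> mD Doo mf cf ig fg.
have mg : measurable_fun D g by have /integrableP[/measurable_EFinP] := ig.
pose h x := Num.min (f x) (g x).
have mh : measurable_fun D h by exact: measurable_minr.
have -> : (\int[mu]_(x in D) (f x)%:E = \int[mu]_(x in D) (h x)%:E)%E.
  apply: ae_eq_integral => //; [exact/measurable_EFinP|exact/measurable_EFinP|].
  apply: filterS fg => x fg Dx; congr EFin.
  by rewrite /h; apply/esym/min_idPl; exact: fg.
have ic : mu.-integrable D (EFin \o cst (- `|c|)).
  apply/integrableP; split; first by apply/measurable_EFinP; exact: measurable_cst.
  by rewrite /= integral_cst// lte_mul_pinfty.
have ih : mu.-integrable D (EFin \o h).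
  apply: (@integrable_squeeze _ _ _ mu D mD (fun x => - `|c| - `|g x|) h g) => //.
    move=> x Dx; rewrite /h ge_min lexx orbT andbT le_min.
    have := cf x Dx; have := ler_norm (- c); have := ler_norm (- g x).
    have := normr_ge0 c; have := normr_ge0 (g x).
    by rewrite !normrN => *; apply/andP; split; lra.
  exact: (integrable_EFinB mD ic (integrable_norm ig)).
apply: le_integral => // x _; by rewrite lee_fin /h ge_min lexx orbT.
Qed.

Lemma energy_ge (R : realType) (a b : R) (chi f g : R -> R) :
  a < b -> internal_energy_density chi ->
  measurable_fun `]a, b[ f -> measurable_fun `]a, b[ g ->
  (forall x, a < x < b -> 0 <= f x + g x) ->
  ((chi 0 * (b - a))%:E <= energy a b chi f g)%E.
Proof.
move=> ab hchi mf mg fg0.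
have mOm : measurable (`]a, b[%classic : set R) by exact: measurable_itv.
have Omoo : (leb `]a, b[%classic < +oo :> \bar R)%E by rewrite /= itvoo_measure// ltry.
have fg0' x : (`]a, b[%classic : set R) x -> 0 <= f x + g x.
  by rewrite /= in_itv; exact: fg0.
have mchi := measurable_density_comp hchi mOm (measurable_funD mf mg) fg0'.
have lb x : (`]a, b[%classic : set R) x -> chi 0 <= chi (f x + g x).
  by move=> xab; apply: density_nd => //; exact: fg0'.
have [Eoo|] := ltP (energy a b chi f g) +oo%E; last first.
  by rewrite leye_eq => /eqP ->; rewrite leey.
have ichi := @integrable_lbound _ _ _ leb _ mOm _ _ Omoo mchi lb Eoo.
rewrite -(Rintegral_cst_itv (chi 0) ab).
have -> : energy a b chi f g = (Rintegral leb `]a, b[ (fun x => chi (f x + g x)))%:E.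
  by rewrite /Rintegral fineK//; exact: (integrable_fin_num _ ichi).
by rewrite lee_fin; apply: le_Rintegral => //; exact: integrable_cst_itv.
Qed.

Lemma minorant_admissible (R : realType) (a b : R) (f p : R -> R) :
  a < b -> (forall x, a < x < b -> 0 <= p x) ->
  admissible a b (mass a b p) f ->
  exists ps : R -> R, [/\ admissible a b (mass a b p) ps,
    forall x, a < x < b -> 0 <= ps x <= p x,
    Wpp 2 a b ps p = 0%E & forall B, measurable B ->
      (\int[leb]_(x in B `&` `]a, b[) (p x)%:E =
       \int[leb]_(x in B `&` `]a, b[) (ps x)%:E)%E].
Proof.
move=> ab p0 af.
have mOm : measurable (`]a, b[%classic : set R) by exact: measurable_itv.
have p0' x : (`]a, b[%classic : set R) x -> 0 <= p x by rewrite /= in_itv; exact: p0.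
have mfin := admissible_fin_num af.
have moo : (mass a b p < +oo)%E by move: mfin; rewrite fin_numElt => /andP[].
have [ps [mps ps0 psE]] := @measurable_minorant _ _ _ leb _ p mOm p0' moo.
have massE : mass a b ps = mass a b p.
  by have := psE setT measurableT; rewrite !setTI /mass => ->.
have ps0' x : a < x < b -> 0 <= ps x <= p x by move=> xab; apply: ps0; rewrite /= in_itv.
have ps00 x : a < x < b -> 0 <= ps x by move=> /ps0'/andP[].
exists ps; split => //.
- split => //; split => //.
  have Omoo : (leb `]a, b[%classic < +oo :> \bar R)%E by rewrite /= itvoo_measure// ltry.
  have psoo : (mass a b ps < +oo)%E by rewrite massE.
  apply: (@integrable_lbound _ _ _ leb _ mOm ps 0 Omoo mps _ psoo).
  by move=> x /ps0 /andP[].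
- rewrite -(Wpp_self 1 mps ps00) /Wpp.
  by rewrite (@eq_couplings _ _ _ ps p ps ps)// => B /psE.
Qed.

Lemma splitting_step (R : realType) (a b tau B : R) (chi ph eh s f g : R -> R) :
  a < b -> 0 < tau -> internal_energy_density chi -> 0 < B ->
  (forall x, a < x < b -> 0 <= ph x /\ 0 <= eh x) ->
  (forall x, a < x < b -> ph x + eh x <= s x) ->
  {ae leb, forall x, a < x < b -> s x <= B} ->
  admissible a b (mass a b ph) f -> admissible a b (mass a b eh) g ->
  (forall p e, admissible a b (mass a b ph) p -> admissible a b (mass a b eh) e ->
    (JKO_functional a b tau chi ph eh f g <= JKO_functional a b tau chi ph eh p e)%E) ->
  {ae leb, forall x, a < x < b -> f x + g x <= B} /\
  energy a b chi f g \is a fin_num /\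
  exists v : R -> R, [/\ measurable_fun `]a, b[ v,
    forall x, a < x < b -> 0 <= v x <= s x &
    (((2 * tau)^-1)%:E * (Wpp 2 a b ph f + Wpp 2 a b eh g) + energy a b chi f g
      <= \int[leb]_(x in `]a, b[) (chi (v x))%:E)%E].
Proof.
move=> ab tau0 hchi B0 pe0 pes sB af ag fgmin.
have mOm : measurable (`]a, b[%classic : set R) by exact: measurable_itv.
have Omoo : (leb `]a, b[%classic < +oo :> \bar R)%E by rewrite /= itvoo_measure// ltry.
have [ps [aps ps0 Wps psE]] := minorant_admissible ab (fun x xab => (pe0 x xab).1) af.
have [es [aes es0 Wes esE]] := minorant_admissible ab (fun x xab => (pe0 x xab).2) ag.
have mR m h : admissible a b m h -> measurable_fun (`]a, b[%classic : set R) h.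
  by move=> [_ [/integrableP[/measurable_EFinP]]].
pose v x := ps x + es x.
have mv : measurable_fun (`]a, b[%classic : set R) v.
  by apply: measurable_funD; [exact: mR aps|exact: mR aes].
have v0 x : a < x < b -> 0 <= v x <= s x.
  move=> xab; have /andP[p1 p2] := ps0 x xab; have /andP[e1 e2] := es0 x xab.
  by have := pes x xab; rewrite /v; lra.
have v0' x : (`]a, b[%classic : set R) x -> 0 <= v x.
  by rewrite /= in_itv /= => /v0/andP[].
have vB : {ae leb, forall x, a < x < b -> v x <= B}.
  apply: (ae_imply (mu := leb)) sB => x sB xab; have /andP[_ vs] := v0 x xab.
  exact: le_trans vs (sB xab).
have mchiv := measurable_density_comp hchi mOm mv v0'.
have Eoo : (energy a b chi ps es < +oo)%E.
  apply: (@le_lt_trans _ _ (\int[leb]_(x in `]a, b[) (chi B)%:E)%E).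
    apply: (@ae_le_integral_lbound _ _ _ leb _ (chi \o v) (cst (chi B)) (chi 0)) => //.
    + by move=> x /v0' vx0; exact: density_nd.
    + exact: integrable_cst_itv.
    + apply: (ae_imply (mu := leb)) vB => x vB xab /=.
      apply: density_nd => //; first exact: v0'.
      by apply: vB; move: xab; rewrite /= in_itv.
  by rewrite integral_cst//= itvoo_measure// ltry.
have Jle : (((2 * tau)^-1)%:E * (Wpp 2 a b f ph + Wpp 2 a b g eh) + energy a b chi f g
      <= energy a b chi ps es)%E.
  by have := fgmin _ _ aps aes; rewrite /JKO_functional Wps Wes adde0 mule0 add0e.
have Ege : ((chi 0 * (b - a))%:E <= energy a b chi f g)%E.
  apply: energy_ge => //; [exact: mR af|exact: mR ag|move=> x xab].
  by rewrite addr_ge0 ?af.1 ?ag.1.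
have W0 : (0 <= Wpp 2 a b f ph + Wpp 2 a b g eh)%E by rewrite adde_ge0// Wpp_ge0.
have t20 : 0 < (2 * tau)^-1 by rewrite invr_gt0 mulr_gt0.
have EfNy : energy a b chi f g != -oo%E.
  by rewrite -ltNye; apply: lt_le_trans Ege; rewrite ltNyr.
have Efoo : (energy a b chi f g < +oo)%E.
  apply: le_lt_trans Eoo; apply: le_trans Jle; rewrite leeDr// mule_ge0// lee_fin ltW//.
have Woo : (Wpp 2 a b f ph + Wpp 2 a b g eh < +oo)%E.
  rewrite ltNge leye_eq; apply/negP => /eqP Wy.
  move: Jle; rewrite Wy gt0_muley ?lte_fin// addye// leye_eq => /eqP Ey.
  by rewrite Ey in Eoo.
have W1oo : (Wpp 2 a b f ph < +oo)%E.
  by apply: le_lt_trans Woo; rewrite leeDl// Wpp_ge0.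
have W2oo : (Wpp 2 a b g eh < +oo)%E.
  by apply: le_lt_trans Woo; rewrite leeDr// Wpp_ge0.
split.
  apply: (JKO_max_principle ab tau0 hchi B0 _ af ag fgmin) => // D mD.
  rewrite psE// esE//.
  have mDO : measurable (D `&` `]a, b[%classic) by exact: measurableI.
  have mS (h : R -> R) : measurable_fun (`]a, b[%classic : set R) h ->
      measurable_fun (D `&` `]a, b[%classic) (fun x => (h x)%:E).
    by move=> mh; apply/measurable_EFinP; apply: measurable_funS mh => // x [].
  have DO x : (D `&` `]a, b[%classic) x -> a < x < b by move=> [_]; rewrite /= in_itv.
  have p0E x : (D `&` `]a, b[%classic) x -> (0 <= (ps x)%:E)%E.
    by move=> /DO/ps0/andP[p0 _]; rewrite lee_fin.
  have e0E x : (D `&` `]a, b[%classic) x -> (0 <= (es x)%:E)%E.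
    by move=> /DO/es0/andP[p0 _]; rewrite lee_fin.
  have mpE : measurable_fun (D `&` `]a, b[%classic) (fun x => (ps x)%:E).
    by apply: mS; exact: mR aps.
  have meE : measurable_fun (D `&` `]a, b[%classic) (fun x => (es x)%:E).
    by apply: mS; exact: mR aes.
  rewrite -ge0_integralD//.
  rewrite -integral_cst//; apply: ae_ge0_le_integral => //.
  - by move=> x Dx; rewrite adde_ge0 ?p0E ?e0E.
  - exact: (mS _ mv).
  - by move=> x _; rewrite lee_fin ltW.
  - apply: (ae_imply (mu := leb)) vB => x vB /DO xab; rewrite -EFinD lee_fin; exact: vB.
split; first by rewrite fin_numE EfNy -ltey.
exists v; split => //; rewrite (Wpp_sym _ _ _ ph) (Wpp_sym _ _ _ eh); exact: Jle.
Qed.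

Lemma reaction_growth (R : realType) (tau C1 C2 : R) (s q A1 A2 : R -> R) :
  0 <= tau -> 0 <= C1 -> 0 <= C2 -> {within `[0, tau], continuous s} ->
  (forall t, 0 <= t <= tau -> 0 <= s t /\ 0 <= q t <= 1) ->
  (forall t, 0 < t < tau -> is_derive t 1 s (s t * (q t * A1 t + (1 - q t) * A2 t))) ->
  (forall t, 0 < t < tau -> A1 t <= C1 /\ A2 t <= C2) ->
  s tau <= expR ((C1 + C2) * tau) * s 0.
Proof.
move=> tau0 C10 C20 cs sq ds A12.
have w t : 0 < t < tau -> 0 <= t <= tau by move=> /andP[? ?]; rewrite !ltW.
apply: (gronwall_multiplicative tau0 cs _ ds) => t tt.
  by have [] := sq t (w t tt).
have [_ /andP[q0 q1]] := sq t (w t tt); have [a1 a2] := A12 t tt.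
have h1 : q t * A1 t <= q t * C1 by rewrite ler_wpM2l.
have h2 : (1 - q t) * A2 t <= (1 - q t) * C2 by rewrite ler_wpM2l// subr_ge0.
have h3 : q t * C1 <= C1 by rewrite ler_piMl.
have h4 : (1 - q t) * C2 <= C2 by rewrite ler_piMl//; lra.
by lra.
Qed.

Lemma bdd_lip2_bound (R : realType) (F : R -> R -> R) : bdd_lip2 F ->
  exists2 M, 0 <= M & forall u v, 0 <= u -> 0 <= v -> F u v <= M.
Proof.
move=> [[M hM] _]; exists M.
  by apply: le_trans (hM 0 0 (lexx _) (lexx _)).
by move=> u v u0 v0; apply: le_trans (ler_norm _) (hM u v u0 v0).
Qed.

Theorem mainTheorem13 (R : realType) (a b T : R) (chi : R -> R)
  (F1 F2 G1 G2 : R -> R -> R) (rho0 eta0 r0 : R -> R) :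
  a < b -> 0 < T ->
  internal_energy_density chi ->
  bdd_lip2 F1 -> bdd_lip2 F2 -> bdd_lip2 G1 -> bdd_lip2 G2 ->
  (forall v, 0 <= v -> 0 <= G1 0 v) -> (forall u, 0 <= u -> 0 <= G2 u 0) ->
  is_BV a b rho0 -> bounded_on a b rho0 -> is_BV a b eta0 -> bounded_on a b eta0 ->
  (forall x, a < x < b -> 0 <= rho0 x /\ 0 <= eta0 x) ->
  is_BV a b r0 -> (forall x, a < x < b -> 0 <= r0 x <= 1) ->
  (forall x, a < x < b -> 0 < rho0 x + eta0 x -> r0 x = rho0 x / (rho0 x + eta0 x)) ->
  let A1 := fun s q => F1 (q * s) ((1 - q) * s) + G2 (q * s) ((1 - q) * s) in
  let A2 := fun s q => G1 (q * s) ((1 - q) * s) + F2 (q * s) ((1 - q) * s) in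
  let A3 := fun s q => F1 (q * s) ((1 - q) * s) - F2 (q * s) ((1 - q) * s) in
  let Sig := fun s q => s * (q * A1 s q + (1 - q) * A2 s q) in
  let Rr := fun s q : R => q * (1 - q) * A3 s q + (1 - q) ^+ 2 * G1 (q * s) ((1 - q) * s)
                        - q ^+ 2 * G2 (q * s) ((1 - q) * s) in
  exists C : R, forall (tau : R) (N : nat)
    (sig r sigh rh rhoM etaM : nat -> R -> R) (Tmap : nat -> R -> R),
    0 < tau < 1 -> N%:R * tau = T ->
    (* initial data *)
    (forall x, a < x < b -> sig 0%N x = rho0 x + eta0 x /\ r 0%N x = r0 x) ->
    (forall n, (n < N)%N ->
      (* reaction step *)
      (forall x, a < x < b -> exists s q : R -> R,
         {within `[0, tau], continuous s} /\ {within `[0, tau], continuous q} /\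
         (forall t, 0 <= t <= tau -> 0 <= s t /\ 0 <= q t <= 1) /\
         (forall t, 0 < t < tau -> is_derive t 1 s (Sig (s t) (q t)) /\
                                  is_derive t 1 q (Rr (s t) (q t))) /\
         s 0 = sig n x /\ q 0 = r n x /\ sigh n x = s tau /\ rh n x = q tau) /\
      (* diffusion step *)
      (let ph := fun x => rh n x * sigh n x in
       let eh := fun x => (1 - rh n x) * sigh n x in
       admissible a b (mass a b ph) (rhoM n) /\ admissible a b (mass a b eh) (etaM n) /\
       (forall p e, admissible a b (mass a b ph) p -> admissible a b (mass a b eh) e ->
          (JKO_functional a b tau chi ph eh (rhoM n) (etaM n) <=
           JKO_functional a b tau chi ph eh p e)%E)) /\
      (forall x, a < x < b -> sig n.+1 x = rhoM n x + etaM n x) /\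
      (* nondecreasing optimal transport map pushing sigma^{n+1} to sigma^{n+1/2} *)
      (forall x y, a < x < b -> a < y < b -> x <= y -> Tmap n x <= Tmap n y) /\
      (forall B : set R, measurable B ->
         (\int[lebesgue_measure]_(x in `]a, b[ `&` (Tmap n @^-1` B)) (sig n.+1 x)%:E =
          \int[lebesgue_measure]_(x in `]a, b[ `&` B) (sigh n x)%:E)%E) /\
      (\int[lebesgue_measure]_(x in `]a, b[) ((x - Tmap n x) ^+ 2 * sig n.+1 x)%:E =
         Wpp 2 a b (sig n.+1) (sigh n))%E /\
      (forall x, a < x < b -> r n.+1 x = rh n (Tmap n x))) ->
    (((2 * tau)^-1)%:E *
      \sum_(0 <= n < N) (Wpp 2 a b (fun x => (rh n x * sigh n x)%R) (rhoM n) +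
                         Wpp 2 a b (fun x => ((1 - rh n x) * sigh n x)%R) (etaM n))
      <= C%:E)%E.
Proof.
move=> ab T0 hchi hF1 hF2 hG1 hG2 _ _ _ [Mr hMr] _ [Me hMe] re0 _ _ _ A1 A2 A3 Sig Rr.
have [c1 c10 hc1] := bdd_lip2_bound hF1; have [c2 c20 hc2] := bdd_lip2_bound hF2.
have [d1 d10 hd1] := bdd_lip2_bound hG1; have [d2 d20 hd2] := bdd_lip2_bound hG2.
pose C := (c1 + d2) + (d1 + c2).
have C0 : 0 <= C by rewrite !addr_ge0.
pose M0 := `|Mr| + `|Me| + 1.
have M00 : 0 < M0 by rewrite ltr_wpDl// addr_ge0.
pose B := M0 * expR (C * T).
have B0 : 0 < B by rewrite mulr_gt0// expR_gt0.
pose L := derive1 chi B.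
have L0 : 0 < L by exact: density_derive1_gt0.
have ba0 : 0 < b - a by rewrite subr_gt0.
exists ((chi B - chi 0) * (b - a) + L * (C * expR C * T) * B * (b - a)).
move=> tau N sig r sigh rh rhoM etaM Tmap /andP[tau0 tau1] NT init H.
pose k := expR (C * tau).
have Ct0 : 0 <= C * tau by rewrite mulr_ge0// ltW.
have k1 : 1 <= k by rewrite -expR0 ler_expR.
have k0 : 0 < k by exact: lt_le_trans k1.
have react n : (n < N)%N -> forall x, a < x < b ->
    [/\ 0 <= sig n x, 0 <= sigh n x, 0 <= rh n x <= 1 & sigh n x <= k * sig n x].
  move=> nN x xab; have [/(_ x xab) hr _] := H n nN.
  have [s [q [cs [_ [sq [ds [s0 [_ [st qt]]]]]]]]] := hr.
  have [s00 _] : 0 <= s 0 /\ 0 <= q 0 <= 1 by apply: sq; rewrite lexx ltW.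
  have [st0 qt0] : 0 <= s tau /\ 0 <= q tau <= 1 by apply: sq; rewrite lexx ltW.
  rewrite -s0 st qt; split => //.
  apply: (@reaction_growth _ tau (c1 + d2) (d1 + c2) s q
    (fun t => A1 (s t) (q t)) (fun t => A2 (s t) (q t))) => //.
  - exact: ltW.
  - exact: addr_ge0.
  - exact: addr_ge0.
  - by move=> t /ds[].
  - move=> t /andP[t0 t1]; have [s0' /andP[q0' q1']] :=
      sq t (andb_true_intro (conj (ltW t0) (ltW t1))).
    have u0 : 0 <= q t * s t by rewrite mulr_ge0.
    have v0 : 0 <= (1 - q t) * s t by rewrite mulr_ge0// subr_ge0.
    by split; rewrite lerD// ?hc1 ?hc2 ?hd1 ?hd2.
pose Mn n := M0 * expR (C * (n%:R * tau)).
have Mn0 n : 0 < Mn n by rewrite mulr_gt0// expR_gt0.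
have MnS n : k * Mn n = Mn n.+1.
  by rewrite /Mn /k mulrCA -expRD -natr1; congr (_ * expR _); ring.
have MnB n : (n <= N)%N -> Mn n <= B.
  move=> nN; rewrite ler_pM2l// ler_expR ler_wpM2l// -NT ler_wpM2r// ?ler_nat//.
  exact: ltW.
have step n : (n < N)%N -> {ae leb, forall x, a < x < b -> sig n x <= Mn n} ->
  {ae leb, forall x, a < x < b -> rhoM n x + etaM n x <= Mn n.+1} /\
  energy a b chi (rhoM n) (etaM n) \is a fin_num /\
  exists v : R -> R, [/\ measurable_fun `]a, b[ v,
    forall x, a < x < b -> 0 <= v x <= k * sig n x &
    (((2 * tau)^-1)%:E * (Wpp 2 a b (fun x => (rh n x * sigh n x)%R) (rhoM n) +
                         Wpp 2 a b (fun x => ((1 - rh n x) * sigh n x)%R) (etaM n)) +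
       energy a b chi (rhoM n) (etaM n)
      <= \int[leb]_(x in `]a, b[) (chi (v x))%:E)%E].
  move=> nN sM; have [_ [[aph [aeh hmin]] _]] := H n nN.
  apply: (splitting_step ab tau0 hchi (Mn0 n.+1) _ _ _ aph aeh hmin).
  - move=> x xab; have [_ h0 /andP[q0 q1] _] := react n nN x xab.
    by rewrite !mulr_ge0// subr_ge0.
  - move=> x xab; have [_ _ _] := react n nN x xab.
    by rewrite -mulrDl (addrC (rh n x)) subrK mul1r.
  - apply: (ae_imply (mu := leb)) sM => x sM xab.
    by rewrite -MnS ler_pM2l// sM.
have sigM n : (n <= N)%N -> {ae leb, forall x, a < x < b -> sig n x <= Mn n}.
  elim: n => [_|n IH nN].
    apply: aeW => x xab; have [-> _] := init x xab.
    rewrite /Mn mul0r mulr0 expR0 mulr1 /M0.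
    have := ler_norm (rho0 x); have := hMr x xab; have := ler_norm Mr.
    have := ler_norm (eta0 x); have := hMe x xab; have := ler_norm Me.
    by lra.
  have [hs _] := step n nN (IH (ltnW nN)).
  have [_ [_ [sE _]]] := H n nN.
  by apply: (ae_imply (mu := leb)) hs => x hs xab; rewrite sE// hs.
pose E n := if n is m.+1 then fine (energy a b chi (rhoM m) (etaM m)) else chi B * (b - a).
pose W n := (Wpp 2 a b (fun x => (rh n x * sigh n x)%R) (rhoM n) +
             Wpp 2 a b (fun x => ((1 - rh n x) * sigh n x)%R) (etaM n))%E.
pose D := L * (k - 1) * B * (b - a).
have mOm : measurable (`]a, b[%classic : set R) by exact: measurable_itv.
have Omoo : (leb `]a, b[%classic < +oo :> \bar R)%E by rewrite /= itvoo_measure// ltry.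
have Omab x : (`]a, b[%classic : set R) x -> a < x < b by rewrite /= in_itv.
have D0 : 0 <= D.
  have k10 : 0 <= k - 1 by rewrite subr_ge0.
  by rewrite /D !mulr_ge0//; exact: ltW.
have dissip n : (n < N)%N -> (((2 * tau)^-1)%:E * W n <= (E n - E n.+1 + D)%:E)%E.
  move=> nN; have sM := sigM n (ltnW nN).
  have [_ [Efin [v [mv v0 vle]]]] := step n nN sM.
  have v0' x : (`]a, b[%classic : set R) x -> 0 <= v x by move=> /Omab/v0/andP[].
  have mchiv := measurable_density_comp hchi mOm mv v0'.
  have chiv0 x : (`]a, b[%classic : set R) x -> chi 0 <= chi (v x).
    by move=> /v0' vx; exact: density_nd.
  have kB : {ae leb, forall x, a < x < b -> k * sig n x <= B}.
    apply: (ae_imply (mu := leb)) sM => x sM xab.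
    by apply: le_trans (MnB n.+1 nN); rewrite -MnS ler_pM2l// sM.
  suff vE : (\int[leb]_(x in `]a, b[) (chi (v x))%:E <= (E n + D)%:E)%E.
    have := le_trans vle vE.
    rewrite -/(W n) -(fineK Efin) -/(E n.+1) -leeBrDr// -EFinB.
    by congr (_ <= _%:E)%E; ring.
  case: n nN sM v0 vle Efin kB => [|m] nN sM v0 vle Efin kB.
    apply: (@le_trans _ _ (\int[leb]_(x in `]a, b[) (chi B)%:E)%E).
      apply: (@ae_le_integral_lbound _ _ _ leb _ (chi \o v) (cst (chi B)) (chi 0)) => //.
        exact: integrable_cst_itv.
      apply: (ae_imply (mu := leb)) kB => x kB /Omab xab /=.
      have /andP[vx0 vxs] := v0 x xab.
      by apply: density_nd => //; exact: le_trans vxs (kB xab).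
    by rewrite integral_cst//= itvoo_measure// -EFinM lee_fin lerDl.
  have mN : (m < N)%N := ltnW nN.
  have [_ [Emfin _]] := step m mN (sigM m (ltnW mN)).
  have [_ [[aph [aeh _]] [sE _]]] := H m mN.
  have [f0 [/integrableP[/measurable_EFinP mf _] _]] := aph.
  have [g0 [/integrableP[/measurable_EFinP mg _] _]] := aeh.
  pose u x := rhoM m x + etaM m x.
  have u0 x : (`]a, b[%classic : set R) x -> 0 <= u x.
    by move=> /Omab xab; rewrite addr_ge0 ?f0 ?g0.
  have mu_ : measurable_fun (`]a, b[%classic : set R) u by exact: measurable_funD.
  have mchiu := measurable_density_comp hchi mOm mu_ u0.
  have chiu0 x : (`]a, b[%classic : set R) x -> chi 0 <= chi (u x).
    by move=> /u0 ux; exact: density_nd.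
  have Emoo : (energy a b chi (rhoM m) (etaM m) < +oo)%E.
    by move: Emfin; rewrite fin_numElt => /andP[].
  have iu := @integrable_lbound _ _ _ leb _ mOm _ _ Omoo mchiu chiu0 Emoo.
  have icst := integrable_cst_itv (L * (k - 1) * B) ab.
  have isum : leb.-integrable `]a, b[ (EFin \o (fun x => chi (u x) + L * (k - 1) * B)).
    exact: (@integrable_EFinD _ _ _ leb _ mOm (chi \o u) (cst (L * (k - 1) * B))).
  apply: (@le_trans _ _ (\int[leb]_(x in `]a, b[) (chi (u x) + L * (k - 1) * B)%:E)%E).
    apply: (@ae_le_integral_lbound _ _ _ leb _ (chi \o v) _ (chi 0)) isum _ => //.
    apply: (ae_imply (mu := leb)) kB => x kB Ox /=; have xab := Omab _ Ox.
    have /andP[vx0 vxs] := v0 x xab.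
    have kux : k * u x <= B by have := kB xab; rewrite sE.
    apply: le_trans (density_dilation hchi k1 (u0 x Ox) kux B0).
    by apply: density_nd => //; move: vxs; rewrite sE.
  have -> : (\int[leb]_(x in `]a, b[) (chi (u x) + L * (k - 1) * B)%:E =
     (Rintegral leb `]a, b[ (fun x => chi (u x) + L * (k - 1) * B))%:E)%E.
    by rewrite /Rintegral fineK//; exact: (integrable_fin_num _ isum).
  have -> : Rintegral leb `]a, b[ (fun x => chi (u x) + L * (k - 1) * B) =
      Rintegral leb `]a, b[ (chi \o u) + Rintegral leb `]a, b[ (fun=> L * (k - 1) * B).
    exact: RintegralD.
  by rewrite Rintegral_cst_itv.
have sumW M : (M <= N)%N ->
    (\sum_(0 <= n < M) ((2 * tau)^-1)%:E * W n <= (E 0%N - E M + M%:R * D)%:E)%E.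
  elim: M => [_|M IH MN]; first by rewrite big_nil subrr mul0r addr0.
  rewrite big_nat_recr//; apply: le_trans (leeD (IH (ltnW MN)) (dissip M MN)) _.
  rewrite -EFinD lee_fin -natr1 mulrDl mul1r.
  by move: (E 0%N) (E M) (E M.+1) (M%:R * D) => e0 e1 e2 e3; lra.
have W0 n : (0 <= W n)%E by rewrite adde_ge0// Wpp_ge0.
rewrite ge0_sume_distrr; last by move=> n _; exact: W0.
apply: le_trans (sumW N (leqnn N)) _; rewrite lee_fin.
have EN : chi 0 * (b - a) <= E N.
  have N0 : N <> 0%N by move=> N0; move: T0; rewrite -NT N0 mul0r ltxx.
  case: N N0 H step sigM dissip sumW {NT MnB react} => // m _ H step sigM _ _ /=.
  have [_ [Emfin _]] := step m (ltnSn m) (sigM m (leqnSn m)).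
  have [_ [[aph [aeh _]] _]] := H m (ltnSn m).
  have [f0 [/integrableP[/measurable_EFinP mf _] _]] := aph.
  have [g0 [/integrableP[/measurable_EFinP mg _] _]] := aeh.
  rewrite -lee_fin fineK//; apply: energy_ge => // x xab.
  by rewrite addr_ge0 ?f0 ?g0.
have kC : N%:R * (k - 1) <= C * expR C * T.
  have h1 : k - 1 <= C * tau * expR C.
    apply: le_trans (expR_sub1_le _) _; rewrite ler_wpM2l// ler_expR.
    by rewrite ler_piMr// ltW.
  apply: le_trans (ler_wpM2l (ler0n _ N) h1) _; rewrite -NT.
  by rewrite le_eqVlt; apply/orP; left; apply/eqP; ring.
have LBba : 0 <= L * B * (b - a) by rewrite !mulr_ge0// ltW.
have := ler_wpM2l LBba kC.
have -> : L * B * (b - a) * (N%:R * (k - 1)) = N%:R * D by rewrite /D; ring.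
have -> : L * B * (b - a) * (C * expR C * T) = L * (C * expR C * T) * B * (b - a) by ring.
rewrite mulrBl /=; lra.
Qed.
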